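(* For each integer $k \geq 2$, the 4-coloring $c_{3k}$ of the faces of the Löbell polyhedron $L_{3k}$ described in the context, in which the top and bottom faces receive the same color, determines an orientable degree-$8$ manifold cover $M_{3k}$ of the Löbell orbifold $\mathbb{H}^3/\Gamma_{3k}$. Since the top and bottom faces of $L_{3k}$ receive the same color, $M_{3k}$ contains a closed geodesic of length $2\delta_{3k}$, where $\delta_n$ denotes the hyperbolic distance between the top and bottom faces of $L_n$. Moreover, for all sufficiently large $k$, the systole of $M_{3k}$ is precisely $2\delta_{3k}$.
   Context: For $n \geq 5$, consider the combinatorial $3$-polyhedron with $2n+2$ faces whose ''top'' and ''bottom'' faces are $n$-gons and whose lateral surface consists of $2n$ pentagons: $n$ upper pentagons $U_i$ and $n$ lower pentagons $V_i$ ($i \in \mathbb{Z}/n$), where $U_i$ is adjacent to the top face, $U_{i\pm 1}$, $V_i$ and $V_{i+1}$, and $V_i$ is adjacent to the bottom face, $V_{i\pm1}$, $U_{i-1}$ and $U_i$. By Andreev's theorem it is realized, uniquely up to isometry, as a compact polyhedron $L_n \subset \mathbb{H}^3$ all of whose dihedral angles are $\pi/2$; this is the Löbell polyhedron $L_n$. Let $\Gamma_n < \mathrm{Isom}(\mathbb{H}^3)$ be the group generated by the reflections in the faces of $L_n$; it is a cocompact lattice, and the quotient $\mathbb{H}^3/\Gamma_n$ is the Löbell orbifold. The coloring $c_{3k}$: let $n = 3k$ with $k \geq 2$. Color the top and bottom faces of $L_{3k}$ with color $4$, and color the lateral pentagons, taken in the cyclic order $V_0, U_0, V_1, U_1, \ldots,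 V_{n-1}, U_{n-1}$, with the colors $1,2,3$ repeated periodically (this closes up because $3$ divides $2n$). Adjacent faces receive distinct colors, and, up to permuting the colors, this is the only coloring of the faces of $L_{3k}$ by four colors in which adjacent faces have distinct colors and the top and bottom faces have the same color. The cover determined by the coloring: let $v_1, v_2, v_3$ be a basis of $(\mathbb{Z}/2)^3$ and put $v_4 = v_1+v_2+v_3$. Let $\varphi \colon \Gamma_{3k} \to (\mathbb{Z}/2)^3$ be the homomorphism sending the reflection in a face of color $j$ to $v_j$. The associated cover is $M_{3k} = \mathbb{H}^3/\ker\varphi$. A manifold cover of $\mathbb{H}^3/\Gamma_n$ of degree $D$ is a quotient $\mathbb{H}^3/\Gamma'$ with $\Gamma' < \Gamma_n$ torsion-free of index $D$. For a lattice $\Gamma < \mathrm{Isom}(\mathbb{H}^d)$, the systole of $\Gamma$, and of $\mathbb{H}^d/\Gamma$, is the minimal translation length of a loxodromic element of $\Gamma$ (an isometry, possibly orientation-reversing, with positive translation length along an invariant axis). *)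

(* Defs.v *)
From HB Require Import structures.
From mathcomp Require Import all_boot all_order all_algebra.
From mathcomp Require Import all_classical all_reals all_analysis.

Set Implicit Arguments.
Unset Strict Implicit.
Unset Printing Implicit Defensive.

Import Order.TTheory GRing.Theory Num.Theory.
Import numFieldNormedType.Exports.

Local Open Scope classical_set_scope.
Local Open Scope ring_scope.

(** * Hyperbolic space, hyperboloid model *)

Section Hyperbolic.
Context {R : realType} {d : nat}.
Implicit Types (x y : 'cV[R]_d.+1) (g h : 'M[R]_d.+1) (G H : set 'M[R]_d.+1).

(* The Minkowski form - x_0 y_0 + x_1 y_1 + ... + x_d y_d. *)
Definition lorentz_mx : 'M[R]_d.+1 :=
  diag_mx (\row_i (if i == ord0 then -1 else 1)).

Definition lorentz x y : R := (x^T *m lorentz_mx *m y) ord0 ord0.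

Definition hyperboloid : set 'cV[R]_d.+1 :=
  [set x | lorentz x x = -1 /\ 0 < x ord0 ord0].

Definition arcosh (u : R) : R := ln (u + Num.sqrt (u ^+ 2 - 1)).

Definition hdist x y : R := arcosh (- lorentz x y).

(* Unit-speed parametrized complete geodesics. *)
Definition geodesic_line (c : R -> 'cV[R]_d.+1) : Prop :=
  (forall t, hyperboloid (c t)) /\ (forall s t, hdist (c s) (c t) = `|s - t|).

(* Isometries of H^d are the matrices g of O^+(d,1), acting by x |-> g *m x.
   For a unit spacelike vector e, [reflection e] maps x to x - 2 <e, x> e: it is
   the reflection in the hyperplane orthogonal to e. *)
Definition reflection (e : 'cV[R]_d.+1) : 'M[R]_d.+1 :=
  1 - 2 *: (e *m (e^T *m lorentz_mx)).

Definition subgroup G : Prop :=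
  [/\ G 1, forall g h, G g -> G h -> G (g * h) & forall g, G g -> G g^-1].

Definition generated_group (S : set 'M[R]_d.+1) : set 'M[R]_d.+1 :=
  [set g | forall G, subgroup G -> S `<=` G -> G g].

Definition torsion_free G : Prop :=
  forall g m, G g -> (0 < m)%N -> g ^+ m = 1 -> g = 1.

Definition left_cosets G H : set (set 'M[R]_d.+1) :=
  [set [set g * h | h in H] | g in G].

(* The quotient H^d / H is a manifold cover of H^d / G of degree D. *)
Definition manifold_cover G H (D : nat) : Prop :=
  [/\ subgroup H, H `<=` G, torsion_free H & (left_cosets G H #= `I_D)%card].

(* A matrix of O^+(d,1) preserves the orientation of H^d iff its determinant
   is 1; H^d / G is orientable when all deck transformations do. *)
Definition orientable_quotient G : Prop := forall g, G g -> \det g = 1.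

(* The points of H^d / G. *)
Definition isom_orbit G x : set 'cV[R]_d.+1 := [set g *m x | g in G].

(* H^d / G contains a closed geodesic of length l: some geodesic line projects
   to an l-periodic path in the quotient. *)
Definition has_closed_geodesic G (l : R) : Prop :=
  0 < l /\ exists2 c, geodesic_line c &
    forall t, isom_orbit G (c (t + l)) = isom_orbit G (c t).

(* g is loxodromic with translation length l. *)
Definition loxodromic g (l : R) : Prop :=
  0 < l /\ exists2 c, geodesic_line c & forall t, g *m c t = c (t + l).

Definition is_systole G (s : R) : Prop :=
  (exists2 g, G g & loxodromic g s) /\
  (forall g l, G g -> loxodromic g l -> s <= l).

End Hyperbolic.

(** * Hyperbolic polyhedra with faces indexed by F, given by the outward unit
    normals e of the bounding half-spaces *)

Section Polyhedra.
Context {R : realType} {d : nat} {F : Type}.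
Variable e : F -> 'cV[R]_d.+1.

Definition polyhedron : set 'cV[R]_d.+1 :=
  [set x | hyperboloid x /\ forall f, lorentz x (e f) <= 0].

Definition face (f : F) : set 'cV[R]_d.+1 :=
  [set x | polyhedron x /\ lorentz x (e f) = 0].

(* The relative interior of the facet f consists of the points of the
   polyhedron lying on no other face. *)
Definition genuine_face (f : F) : Prop :=
  exists x, polyhedron x /\ forall h, lorentz x (e h) = 0 <-> h = f.

(* Two distinct facets meet along a codimension-two face iff some point of the
   polyhedron lies on these two facets and on no other one. *)
Definition share_edge (f g : F) : Prop :=
  f <> g /\ exists x, polyhedron x /\
    forall h, lorentz x (e h) = 0 <-> h = f \/ h = g.

(* Interior angle: its cosine is - <e_f, e_g> since the normals point
   outwards. *)
Definition dihedral_angle (f g : F) : R := acos (- lorentz (e f) (e g)).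

Definition compact_polyhedron : Prop :=
  [/\ forall f, lorentz (e f) (e f) = 1,
      compact polyhedron,
      exists x, hyperboloid x /\ forall f, lorentz x (e f) < 0
    & forall f, genuine_face f].

Definition reflection_group : set 'M[R]_d.+1 :=
  generated_group [set reflection (e f) | f in setT].

Definition face_distance (f g : F) : R :=
  inf [set hdist x y | x in face f & y in face g].

End Polyhedra.

(** * The Loebell polyhedra *)

Inductive lobell_face (n : nat) : Type :=
  | Top | Bottom | Upper of 'I_n | Lower of 'I_n.
Arguments Top {n}.
Arguments Bottom {n}.

(* [ordS i] is i + 1 modulo n. *)
Definition lobell_adjacent n (f g : lobell_face n) : bool :=
  match f, g with
  | Top, Upper _ | Upper _, Top | Bottom, Lower _ | Lower _, Bottom => true
  | Upper i, Upper j | Lower i, Lower j => (j == ordS i) || (i == ordS j)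
  | Upper i, Lower j | Lower j, Upper i => (j == i) || (j == ordS i)
  | _, _ => false
  end.

(* e are the outward unit normals of a compact right-angled polyhedron in H^3
   of the combinatorial type of L_n; the face adjacencies determine this type
   because the dual graph is planar and 3-connected. *)
Definition lobell_polyhedron (R : realType) n
    (e : lobell_face n -> 'cV[R]_4) : Prop :=
  [/\ compact_polyhedron e,
      forall f g, share_edge e f g <-> lobell_adjacent f g
    & forall f g, share_edge e f g -> dihedral_angle e f g = pi / 2].

(* V_i and U_i have positions 2i and 2i + 1 in the cyclic order
   V_0, U_0, V_1, U_1, ... of the lateral faces. *)
Definition lobell_color n (f : lobell_face n) : nat :=
  match f with
  | Top | Bottom => 4
  | Lower i => ((2 * i) %% 3).+1
  | Upper i => ((2 * i + 1) %% 3).+1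
  end.

(* The vector v_j attached to the color j, with v_4 = v_1 + v_2 + v_3. *)
Definition color_vector (v1 v2 v3 : 'rV['F_2]_3) (j : nat) : 'rV['F_2]_3 :=
  match j with
  | 1%N => v1
  | 2%N => v2
  | 3%N => v3
  | _ => v1 + v2 + v3
  end.

(* phi restricts to the homomorphism from the reflection group to (Z/2)^3
   sending the reflection in a face of color j to v_j; its values outside the
   reflection group are irrelevant. *)
Definition coloring_hom (R : realType) n (e : lobell_face n -> 'cV[R]_4)
    (v1 v2 v3 : 'rV['F_2]_3) (phi : 'M[R]_4 -> 'rV['F_2]_3) : Prop :=
  (forall g h, reflection_group e g -> reflection_group e h ->
     phi (g * h) = phi g + phi h) /\
  (forall f, phi (reflection (e f)) = color_vector v1 v2 v3 (lobell_color f)).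

Definition coloring_kernel (R : realType) n (e : lobell_face n -> 'cV[R]_4)
    (phi : 'M[R]_4 -> 'rV['F_2]_3) : set 'M[R]_4 :=
  [set g | reflection_group e g /\ phi g = 0].

(* Main.v *)
From HB Require Import structures.
Require Import Defs.
From mathcomp Require Import all_boot all_order all_algebra.
From mathcomp Require Import all_classical all_reals all_analysis.
From mathcomp Require Import ring lra zify.

Set Implicit Arguments.
Unset Strict Implicit.
Unset Printing Implicit Defensive.

Import Order.TTheory GRing.Theory Num.Theory.
Import numFieldNormedType.Exports.

Local Open Scope ring_scope.

Local Notation "⟨ x , y ⟩" := (lorentz x y) (at level 0, x at level 99, y at level 99).

(** Write [⟨x, y⟩] for the Minkowski form and [e f] for the outward normals.

    The whole proof only sees the Gram matrix of the normals. In a compact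
    right-angled polyhedron the faces [f] and [g] satisfy [⟨e f, e g⟩ = 0] when
    they share an edge ([lobell_share_orth]) and [⟨e f, e g⟩ < -1] when they do
    not ([nonadjacent_ultraparallel]): the projection of the polyhedron to the
    hyperplane of a face stays in the face ([face_projection]), so distinct
    normals have products at most [0] ([acute]); hence nonadjacent hyperplanes that met would contain a common edge, and hyperplanes that met at
    infinity would make the polyhedron unbounded.

    A Gram matrix with entries [1], [0] and numbers below [-1] controls the
    reflection group as in the theory of Coxeter groups. Every word is equal
    in the group to a climbing word, obtained by deleting pairs of equal letters
    that only commuting letters separate ([climbing_chamber]), and a nonempty
    climbing word moves an interior point out of the polyhedron. This shows that
    relations do not change colors, so the coloring homomorphism exists
    ([word_color_relation]). A descent shows that the translates of the
    polyhedron cover hyperbolic space ([polyhedron_cover]). Hence an element of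
    finite order is conjugate to one that fixes a point of the polyhedron; it is
    a product of reflections in pairwise orthogonal faces through this point
    ([climbing_stabilizer]). Such faces have independent color vectors because
    their colors are distinct and miss one of the four, so no such element other
    than [1] lies in the kernel ([word_torsion_free]). The kernel preserves the
    orientation because all four color vectors take the value [1] under one
    linear form. The composition of the reflections in the two bases lies in the kernel because
    the bases have the same color, and it translates along their common
    perpendicular by [2 * delta], where [delta] is the distance of the bases
    ([perpendicular_loxodromic], [face_distance_perpendicular]).

    For the systole, let [cosh r] be a lower bound of [- ⟨e f, e g⟩] over the
    pairs of disjoint faces. The axis of a loxodromic element [g], suitably
    conjugated, crosses the hyperplane of some face [f] transversally, so its
    translation length is at least the distance of this hyperplane to its
    image under [g] ([translation_crossing]). Both hyperplanes have the same
    type; a path between them has to leave a chamber with face [f] through a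
    face disjoint from [f], and likewise has to enter the last chamber, so the
    distance is at least [2 * r] ([climbing_root_far]). It remains to see that
    one can take [r = delta].

    This needs the actual shape of the polyhedron. Three consecutive lateral
    faces are mutually orthogonal, which gives an algebraic relation between
    their distances to the bases ([p_relation]). A maximum principle for this
    relation shows that all these distances agree ([p_const]), so the
    polyhedron has the full rotational symmetry, the normals of the lateral
    faces turn by a constant angle [psi] around the common perpendicular, and
    [psi = pi / n] because they turn only once ([psi_N]). All products of
    normals are then explicit in [psi] ([lateral_lorentz]); in particular
    [cosh delta = cos psi / cos (2 * psi)], which tends to [1], and this is the
    smallest of the relevant numbers as soon as [8 <= n]
    ([Top_Bottom_closest]). *)

(** * The Lorentz form *)

Section LorentzForm.
Context {R : realType} {d : nat}.
Implicit Types (x y z e : 'cV[R]_d.+1) (a b : R).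

Lemma lorentzE x y :
  ⟨x, y⟩ = - x ord0 ord0 * y ord0 ord0
             + \sum_(i < d) x (lift ord0 i) ord0 * y (lift ord0 i) ord0.
Proof.
have JE i : (lorentz_mx *m y) i ord0 = (if i == ord0 then -1 else 1) * y i ord0.
  rewrite mxE (bigD1 i) //= big1 ?addr0 ?mxE ?eqxx ?mulr1n ?mxE // => j ji.
  by rewrite !mxE (eq_sym i j) (negPf ji) mulr0n mul0r.
rewrite /lorentz -mulmxA mxE big_ord_recl JE eqxx mxE; congr (_ + _); first by ring.
by apply: eq_bigr => i _; rewrite JE mxE (eq_sym _ ord0) (negPf (neq_lift _ _)) mul1r.
Qed.

Lemma lorentzC x y : ⟨x, y⟩ = ⟨y, x⟩.
Proof.
rewrite !lorentzE; congr (_ + _); first by ring.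
by apply: eq_bigr => i _; ring.
Qed.

Lemma lorentzDl x y z : ⟨x + y, z⟩ = ⟨x, z⟩ + ⟨y, z⟩.
Proof. by rewrite /lorentz linearD /= !mulmxDl mxE. Qed.

Lemma lorentzZl a x z : ⟨a *: x, z⟩ = a * ⟨x, z⟩.
Proof. by rewrite /lorentz linearZ /= -!scalemxAl mxE. Qed.

Lemma lorentzDr x y z : ⟨z, x + y⟩ = ⟨z, x⟩ + ⟨z, y⟩.
Proof. by rewrite lorentzC lorentzDl !(lorentzC z). Qed.

Lemma lorentzZr a x z : ⟨z, a *: x⟩ = a * ⟨z, x⟩.
Proof. by rewrite lorentzC lorentzZl (lorentzC z). Qed.

Lemma lorentzNl x z : ⟨- x, z⟩ = - ⟨x, z⟩.
Proof. by rewrite -scaleN1r lorentzZl mulN1r. Qed.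

Lemma lorentzNr x z : ⟨z, - x⟩ = - ⟨z, x⟩.
Proof. by rewrite lorentzC lorentzNl lorentzC. Qed.

Lemma lorentz0l z : ⟨0, z⟩ = 0.
Proof. by rewrite -(scale0r 0) lorentzZl mul0r. Qed.

Definition lorentzL := (lorentzDl, lorentzDr, lorentzZl, lorentzZr, lorentzNl, lorentzNr).

Lemma Cauchy_of_psd a b (c : R) :
  (forall s t, 0 <= s ^+ 2 * a + 2 * s * t * b + t ^+ 2 * c) -> b ^+ 2 <= a * c.
Proof.
move=> psd.
have a0 : 0 <= a by have := psd 1 0; rewrite !expr2; lra.
have [a00|an0] := eqVneq a 0.
  rewrite a00; have [->|bn0] := eqVneq b 0; first by rewrite expr2; lra.
  have := psd ((- c - 1) / (2 * b)) 1; rewrite a00.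
  suff -> : ((- c - 1) / (2 * b)) ^+ 2 * 0 + 2 * ((- c - 1) / (2 * b)) * 1 * b
            + 1 ^+ 2 * c = - 1 by rewrite oppr_ge0 ler10.
  by field.
have := psd (- b) a.
have -> : (- b) ^+ 2 * a + 2 * - b * a * b + a ^+ 2 * c = a * (a * c - b ^+ 2)
  by ring.
by rewrite pmulr_rge0 ?lt_def ?an0 // subr_ge0.
Qed.

Lemma sum_Cauchy (f g : 'I_d -> R) :
  (\sum_i f i * g i) ^+ 2 <= (\sum_i f i ^+ 2) * (\sum_i g i ^+ 2).
Proof.
apply: Cauchy_of_psd => s t.
have -> : s ^+ 2 * (\sum_i f i ^+ 2) + 2 * s * t * (\sum_i f i * g i)
    + t ^+ 2 * (\sum_i g i ^+ 2) = \sum_i (s * f i + t * g i) ^+ 2.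
  rewrite !mulr_sumr -!big_split /=; apply: eq_bigr => i _; ring.
by apply: sumr_ge0 => i _; rewrite sqr_ge0.
Qed.

Lemma lorentz_sq x :
  ⟨x, x⟩ = - x ord0 ord0 ^+ 2 + \sum_(i < d) x (lift ord0 i) ord0 ^+ 2.
Proof.
by rewrite lorentzE mulNr -expr2; congr (_ + _); apply: eq_bigr => i _; rewrite expr2.
Qed.

(** The form has only one negative square. *)
Lemma timelike_orth x y : ⟨x, x⟩ < 0 -> ⟨x, y⟩ = 0 -> 0 <= ⟨y, y⟩.
Proof.
rewrite (lorentz_sq x) (lorentz_sq y) lorentzE.
have := sum_Cauchy (fun i => x (lift ord0 i) ord0) (fun i => y (lift ord0 i) ord0).
set a := x ord0 ord0; set b := y ord0 ord0.
set S := (\sum_i x _ _ * y _ _); set A := (\sum_i x _ _ ^+ 2).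
set B := (\sum_i y _ _ ^+ 2) => CS xx xy.
have B0 : 0 <= B by apply: sumr_ge0 => i _; rewrite sqr_ge0.
have SE : S = a * b by lra.
have a0 : 0 < a ^+ 2.
  have : 0 <= A by apply: sumr_ge0 => i _; rewrite sqr_ge0.
  by move: xx; lra.
rewrite -(pmulr_rge0 _ a0).
have : A * B <= a ^+ 2 * B by apply: ler_wpM2r => //; lra.
by move: CS; rewrite SE exprMn; lra.
Qed.

Lemma timelike_orth_eq0 x y :
  ⟨x, x⟩ < 0 -> ⟨x, y⟩ = 0 -> ⟨y, y⟩ = 0 -> y = 0.
Proof.
rewrite (lorentz_sq x) (lorentz_sq y) lorentzE.
have := sum_Cauchy (fun i => x (lift ord0 i) ord0) (fun i => y (lift ord0 i) ord0).
set a := x ord0 ord0; set b := y ord0 ord0.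
set S := (\sum_i x _ _ * y _ _); set A := (\sum_i x _ _ ^+ 2).
set B := (\sum_i y _ _ ^+ 2) => CS xx xy yy.
have SE : S = a * b by lra.
have BE : B = b ^+ 2 by lra.
have b0 : b = 0.
  apply/eqP; rewrite -sqrf_eq0; apply/eqP.
  have b2 : 0 <= b ^+ 2 by rewrite sqr_ge0.
  move: CS; rewrite SE BE exprMn => CS.
  have : 0 <= (A - a ^+ 2) * b ^+ 2 by rewrite mulrBl subr_ge0.
  rewrite nmulr_rge0; last by lra.
  by move=> ?; lra.
have B0 : B = 0 by rewrite BE b0 expr2 mul0r.
apply/matrixP => i j; rewrite ord1 mxE.
case: (unliftP ord0 i) => [k|] -> //.
apply/eqP; rewrite -sqrf_eq0; apply/eqP.
by move/psumr_eq0P: B0 => -> // l _; rewrite sqr_ge0.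
Qed.

(** The form is positive on the orthogonal complement of a timelike vector. *)
Lemma orth_Cauchy x y z : ⟨x, x⟩ < 0 -> ⟨x, y⟩ = 0 -> ⟨x, z⟩ = 0 ->
  ⟨y, z⟩ ^+ 2 <= ⟨y, y⟩ * ⟨z, z⟩.
Proof.
move=> xx xy xz; apply: Cauchy_of_psd => s t.
have : 0 <= ⟨s *: y + t *: z, s *: y + t *: z⟩.
  by apply: timelike_orth xx _; rewrite !lorentzL xy xz; ring.
by rewrite !lorentzL (lorentzC z y); move: (⟨y, z⟩) => *; lra.
Qed.

(** ** The future cone *)

Definition future x := ⟨x, x⟩ < 0 /\ 0 < x ord0 ord0.

Lemma hyperboloid_future x : hyperboloid x -> future x.
Proof. by case=> xx x0; split=> //; rewrite xx ltrN10. Qed.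

Lemma future_space x : future x ->
  \sum_(i < d) x (lift ord0 i) ord0 ^+ 2 < x ord0 ord0 ^+ 2.
Proof. by case; rewrite lorentz_sq => *; lra. Qed.

Lemma sum_lt_time x y : future x -> ⟨y, y⟩ <= 0 -> 0 < y ord0 ord0 -> ⟨x, y⟩ < 0.
Proof.
move=> fx yy y0; have := future_space fx; case: fx => _ x0.
move: yy; rewrite lorentz_sq lorentzE.
have := sum_Cauchy (fun i => x (lift ord0 i) ord0) (fun i => y (lift ord0 i) ord0).
set a := x ord0 ord0 in x0 *; set b := y ord0 ord0 in y0 *.
set S := (\sum_i x _ _ * y _ _); set A := (\sum_i x _ _ ^+ 2).
set B := (\sum_i y _ _ ^+ 2) => CS yy xx.
have A0 : 0 <= A by apply: sumr_ge0 => i _; rewrite sqr_ge0.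
suff : S < a * b by lra.
have ab0 : 0 <= a * b by rewrite mulr_ge0 ?ltW.
apply: le_lt_trans (ler_norm _) _; rewrite -(ger0_norm ab0).
rewrite -ltr_sqr ?nnegrE ?normr_ge0 // !real_normK ?num_real // exprMn.
apply: le_lt_trans CS _.
apply: (@le_lt_trans _ _ (A * b ^+ 2)); first by apply: ler_wpM2l => //; lra.
by rewrite ltr_pM2r // exprn_gt0.
Qed.

Lemma future_lt0 x y : future x -> future y -> ⟨x, y⟩ < 0.
Proof. by move=> fx [yy y0]; apply: sum_lt_time => //; apply: ltW. Qed.

Lemma future_of_lt0 x y : future x -> ⟨y, y⟩ < 0 -> ⟨x, y⟩ < 0 -> future y.
Proof.
move=> fx yy xy; split=> //; rewrite ltNge; apply/negP => y0.
have [y00|yn0] := eqVneq (y ord0 ord0) 0.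
  have := future_space fx; move: yy; rewrite lorentz_sq y00.
  have : 0 <= \sum_(i < d) y (lift ord0 i) ord0 ^+ 2.
    by apply: sumr_ge0 => i _; rewrite sqr_ge0.
  by rewrite expr2; lra.
have fNy : future (- y).
  split; first by rewrite !lorentzL; lra.
  by rewrite mxE oppr_gt0 lt_def eq_sym yn0.
by have := future_lt0 fx fNy; rewrite lorentzL; lra.
Qed.

Lemma futureD x y : future x -> future y -> future (x + y).
Proof.
move=> fx fy; have xy := future_lt0 fx fy; split.
  by rewrite !lorentzL (lorentzC y x); case: fx fy => [xx _] [yy _]; lra.
by rewrite mxE addr_gt0 //; [case: fx|case: fy].
Qed.

Lemma futureZ a x : 0 < a -> future x -> future (a *: x).
Proof.
move=> a0 [xx x0]; split; last by rewrite mxE mulr_gt0.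
by rewrite !lorentzL !pmulr_rlt0.
Qed.

Definition normalize x := (Num.sqrt (- ⟨x, x⟩))^-1 *: x.

Lemma normalize_coef x : future x -> 0 < (Num.sqrt (- ⟨x, x⟩))^-1.
Proof. by case=> xx _; rewrite invr_gt0 sqrtr_gt0 oppr_gt0. Qed.

Lemma normalize_hyperboloid x : future x -> hyperboloid (normalize x).
Proof.
move=> fx; have c0 := normalize_coef fx; split; last by case: (futureZ c0 fx).
case: fx => xx _; rewrite !lorentzL mulrA -expr2 exprVn sqr_sqrtr; last by lra.
by field; lra.
Qed.

(** The reversed Cauchy-Schwarz inequality, for two timelike vectors. *)
Lemma hyperboloid_ge1 x y : hyperboloid x -> hyperboloid y -> 1 <= - ⟨x, y⟩.
Proof.
move=> hx hy; have xy := future_lt0 (hyperboloid_future hx) (hyperboloid_future hy).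
case: (hx) => xx _; case: (hy) => yy _.
have : 0 <= ⟨y + ⟨x, y⟩ *: x, y + ⟨x, y⟩ *: x⟩.
  apply: (@timelike_orth x); first by rewrite xx; lra.
  by rewrite !lorentzL xx; ring.
rewrite !lorentzL xx yy (lorentzC y x) => h.
have : 0 <= (- ⟨x, y⟩ - 1) * (1 - ⟨x, y⟩).
  by move: (⟨x, y⟩) h => t; lra.
by rewrite pmulr_lge0; lra.
Qed.

(** A bound on time coordinates bounds distances. *)
Lemma hyperboloid_time_bound x y : hyperboloid x -> hyperboloid y ->
  - ⟨x, y⟩ <= 2 * x ord0 ord0 * y ord0 ord0.
Proof.
move=> hx hy; have fx := hyperboloid_future hx; have fy := hyperboloid_future hy.
have := future_space fx; have := future_space fy.
case: fx fy => _ + [_ +]; rewrite lorentzE.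
have := sum_Cauchy (fun i => x (lift ord0 i) ord0) (fun i => y (lift ord0 i) ord0).
set a := x ord0 ord0; set b := y ord0 ord0.
set S := (\sum_i x _ _ * y _ _); set A := (\sum_i x _ _ ^+ 2).
set B := (\sum_i y _ _ ^+ 2) => CS a0 b0 Bb Aa.
have A0 : 0 <= A by apply: sumr_ge0 => i _; rewrite sqr_ge0.
have B0 : 0 <= B by apply: sumr_ge0 => i _; rewrite sqr_ge0.
suff : - S <= a * b by lra.
have ab0 : 0 <= a * b by rewrite mulr_ge0 ?ltW.
apply: le_trans (ler_norm _) _; rewrite normrN -(ger0_norm ab0).
rewrite -ler_sqr ?nnegrE ?normr_ge0 // !real_normK ?num_real // exprMn.
by apply: le_trans CS _; apply: ler_pM => //; apply: ltW.
Qed.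

(** ** Reflections *)

Lemma reflectionE e x : reflection e *m x = x - (2 * ⟨x, e⟩) *: e.
Proof.
rewrite /reflection mulmxBl mul1mx -scalemxAl -mulmxA -mulmxA.
rewrite [e^T *m _]mulmxA (mx11_scalar (e^T *m _ *m x)) -/(lorentz e x).
by rewrite mul_mx_scalar scalerA lorentzC.
Qed.

Lemma mulmx_ext (A B : 'M[R]_d.+1) :
  (forall x : 'cV[R]_d.+1, A *m x = B *m x) -> A = B.
Proof.
move=> AB; apply/matrixP => i j.
by have := AB (delta_mx j ord0); rewrite -!colE => /matrixP /(_ i ord0); rewrite !mxE.
Qed.

Lemma reflection_sq e : ⟨e, e⟩ = 1 -> reflection e * reflection e = 1.
Proof.
move=> ee; apply: mulmx_ext => x; rewrite mul1mx -[_ * _]/(_ *m _) -mulmxA.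
rewrite !reflectionE !lorentzL ee.
have -> : 2 * (⟨x, e⟩ - 2 * ⟨x, e⟩ * 1) = - (2 * ⟨x, e⟩) by ring.
by rewrite scaleNr opprK subrK.
Qed.

Definition preserves_lorentz (g : 'M[R]_d.+1) := forall x y, ⟨g *m x, g *m y⟩ = ⟨x, y⟩.

Lemma reflection_lorentz e : ⟨e, e⟩ = 1 -> preserves_lorentz (reflection e).
Proof.
move=> ee x y; rewrite !reflectionE !lorentzL ee (lorentzC e y); ring.
Qed.

Lemma reflection_future e x : ⟨e, e⟩ = 1 -> future x -> future (reflection e *m x).
Proof.
move=> ee fx; apply: (future_of_lt0 fx).
  by rewrite reflection_lorentz //; case: fx.
rewrite reflectionE !lorentzL.
case: fx => xx _; suff : 0 <= ⟨x, e⟩ ^+ 2 by rewrite expr2; lra.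
exact: sqr_ge0.
Qed.

(** Both sides are the determinant of the block matrix with blocks [1], [- v],
    [u] and [1], which has two block triangular factorizations. *)
Lemma det_rank1 (u : 'cV[R]_d.+1) (v : 'rV[R]_d.+1) :
  \det (1%:M + u *m v) = 1 + (v *m u) ord0 ord0.
Proof.
pose A := block_mx 1%:M (- v) u (1%:M : 'M[R]_d.+1).
have E1 : A = block_mx 1%:M 0 u 1%:M *m block_mx 1%:M (- v) 0 (1%:M + u *m v).
  rewrite mulmx_block !mul1mx !mul0mx !mulmx1 !addr0 mulmxN.
  by rewrite addrCA addNr addr0.
have E2 : A = block_mx (1%:M + v *m u) (- v) 0 1%:M *m block_mx 1%:M 0 u 1%:M.
  rewrite mulmx_block !mul1mx !mul0mx !mulmx1 !mulmx0 !add0r mulNmx.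
  by rewrite addrK.
have : \det A = \det A by [].
rewrite {1}E1 E2 !det_mulmx !det_ublock !det_lblock !det1 !mul1r !mulr1 => ->.
by rewrite (mx11_scalar (1%:M + _)) det_scalar1 !mxE eqxx.
Qed.

Lemma det_reflection e : ⟨e, e⟩ = 1 -> \det (reflection e) = -1.
Proof.
move=> ee; rewrite /reflection scalemxAl -mulNmx det_rank1.
rewrite -[(_ *m _) ord0 ord0]/((_ *m _) 0 0) mulmxN -scalemxAr 2!mxE -/(lorentz e e) ee; ring.
Qed.

End LorentzForm.

(** * Acute-angled polyhedra *)

Section SmallParameters.
Context {R : realType}.
Implicit Types (a b c s : R).

(** Properties of all sufficiently small positive numbers; finitely many of them
    hold simultaneously, which is what perturbation arguments need. *)
Definition for_small (P : R -> Prop) := exists2 eps, 0 < eps & forall s, 0 < s <= eps -> P s.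

Lemma for_small_ex (P : R -> Prop) : for_small P -> exists2 s, 0 < s & P s.
Proof. by case=> eps e0 h; exists eps => //; apply: h; rewrite e0 lexx. Qed.

Lemma for_small_and (P Q : R -> Prop) :
  for_small P -> for_small Q -> for_small (fun s => P s /\ Q s).
Proof.
move=> [a a0 Pa] [b b0 Qb]; exists (Num.min a b); first by rewrite lt_min a0.
by move=> s /andP[s0]; rewrite le_min => /andP[sa sb]; split; [apply: Pa|apply: Qb]; rewrite s0.
Qed.

Lemma for_small_forall (I : finType) (P : I -> R -> Prop) :
  (forall i, for_small (P i)) -> for_small (fun s => forall i, P i s).
Proof.
move=> h; suff : for_small (fun s => forall i, i \in enum I -> P i s).
  by case=> a a0 ha; exists a => // s sa i; apply: ha => //; rewrite mem_enum.
elim: (enum I) => [|i l IH]; first by exists 1.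
have [a a0 ha] := for_small_and (h i) IH; exists a => // s /ha[Pi Pl] j.
by rewrite inE => /predU1P[->|/Pl].
Qed.

Lemma for_small_quad a b c : a < 0 -> for_small (fun s => a + s * b + s ^+ 2 * c < 0).
Proof.
move=> a0; pose M := `|b| + `|c| + 1.
have M0 : 0 < M by rewrite ltr_wpDl // addr_ge0.
have b1 := ler_norm b; have c1 := ler_norm c.
exists (Num.min 1 (- a / (2 * M))).
  by rewrite lt_min ltr01 divr_gt0 ?mulr_gt0 ?oppr_gt0 // ltr0n.
move=> s /andP[s0]; rewrite le_min => /andP[s1].
rewrite ler_pdivlMr ?mulr_gt0 ?ltr0n // => sM.
have h1 : s * b <= s * `|b| by rewrite ler_pM2l.
have h2 : s ^+ 2 * c <= s * `|c|.
  have : s ^+ 2 * c <= s ^+ 2 * `|c| by rewrite ler_pM2l // exprn_gt0.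
  move/le_trans; apply; apply: ler_wpM2r; rewrite ?normr_ge0 //.
  by rewrite expr2 ger_pMr.
have h3 : 2 * s * (`|b| + `|c|) <= - a - 2 * s by rewrite /M in sM; lra.
have h4 : 0 <= s * (`|b| + `|c|) by rewrite mulr_ge0 ?addr_ge0 // ltW.
lra.
Qed.

Lemma for_small_lin a b : a < 0 -> for_small (fun s => a + s * b < 0).
Proof. by move/(for_small_quad b 0) => [x x0 h]; exists x => // s /h; lra. Qed.

Lemma for_small_neq0 a b : (a != 0) || (b != 0) -> for_small (fun s => a + s * b != 0).
Proof.
have [-> /= b0|a0 _] := eqVneq a 0.
  by exists 1 => // s /andP[s0 _]; rewrite add0r mulf_neq0 // gt_eqF.
case: (ltrgtP a 0) a0 => // a0 _.
  by have [x x0 h] := for_small_lin b a0; exists x => // s /h; lra.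
have [x x0 h] : for_small (fun s => - a + s * (- b) < 0) by apply: for_small_lin; lra.
by exists x => // s /h; lra.
Qed.

End SmallParameters.

Section AcutePolyhedra.
Context {R : realType} {d : nat} {F : finType}.
Variable e : F -> 'cV[R]_d.+1.
Hypothesis compact_e : compact_polyhedron e.
Hypothesis right_angled : forall f g, share_edge e f g -> ⟨e f, e g⟩ = 0.

Let unit_e f : ⟨e f, e f⟩ = 1. Proof. by case: compact_e. Qed.

Lemma polyhedron_time_bound : exists B, forall x, polyhedron e x -> x ord0 ord0 <= B.
Proof.
case: compact_e => _ cP _ _.
have /compact_bounded [M [_ hM]] : compact ((fun x : 'cV[R]_d.+1 => x ord0 ord0) @` polyhedron e)%classic.
  apply: continuous_compact => //; apply: continuous_subspaceT.
  exact: coord_continuous.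
exists (M + 1) => x Px; have := hM (M + 1) _ (x ord0 ord0).
by rewrite ltrDl ltr01 => /(_ isT) h; apply: le_trans (ler_norm _) _; apply: h; exists x.
Qed.

Lemma polyhedron_lorentz_bound :
  exists B, forall x y, polyhedron e x -> polyhedron e y -> - ⟨x, y⟩ <= B.
Proof.
have [B hB] := polyhedron_time_bound; exists (2 * B * B) => x y Px Py.
have [hx _] := Px; have [hy _] := Py.
have x0 := (hyperboloid_future hx).2; have y0 := (hyperboloid_future hy).2.
apply: le_trans (hyperboloid_time_bound hx hy) _.
apply: ler_pM; [by rewrite mulr_ge0 // ltW|exact: ltW| |exact: hB].
by rewrite ler_pM2l // hB.
Qed.

(** Inner points are not normalized to the hyperboloid, so that they can be
    perturbed linearly. *)
Definition inner_point f (x : 'cV[R]_d.+1) :=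
  [/\ future x, ⟨x, e f⟩ = 0 & forall h, h <> f -> ⟨x, e h⟩ < 0].

Lemma inner_point_exists f : exists x, inner_point f x.
Proof.
case: compact_e => _ _ _ /(_ f) [x [[hx Px] fx]]; exists x; split.
- exact: hyperboloid_future.
- exact/fx.
- by move=> h hf; rewrite lt_def Px andbT; apply/eqP => /esym/fx.
Qed.

Lemma share_edge_witness f g (z : 'cV[R]_d.+1) : f <> g -> future z ->
  ⟨z, e f⟩ = 0 -> ⟨z, e g⟩ = 0 ->
  (forall h, h <> f -> h <> g -> ⟨z, e h⟩ < 0) -> share_edge e f g.
Proof.
move=> fg fz zf zg zh; split=> //; exists (normalize z).
have c0 := normalize_coef fz.
have z0 h : ⟨z, e h⟩ <= 0.
  have [->|hf] := pselect (h = f); first by rewrite zf.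
  have [->|hg] := pselect (h = g); first by rewrite zg.
  exact/ltW/zh.
split=> [|h].
  split=> [|h]; first exact: normalize_hyperboloid.
  by rewrite lorentzL pmulr_rle0.
rewrite lorentzL; split; last by case=> ->; rewrite ?zf ?zg mulr0.
move/eqP; rewrite mulf_eq0 gt_eqF //= => /eqP zh0.
apply: contrapT => /not_orP[hf hg].
by have := zh _ hf hg; rewrite zh0 ltxx.
Qed.

(** If the combination of [e h] and [e k] were a multiple of [e f], then inner
    points of [h] and of [k] would give its coefficient incompatible signs. *)
Lemma not_tangent_pencil f h k (q : 'cV[R]_d.+1) :
  f <> h -> f <> k -> h <> k -> 0 < ⟨q, e h⟩ -> 0 < ⟨q, e k⟩ ->
  exists2 v, ⟨v, e f⟩ = 0 & ⟨v, ⟨q, e k⟩ *: e h - ⟨q, e h⟩ *: e k⟩ != 0.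
Proof.
move=> fh fk hk qh qk.
set n := _ - _; pose l := ⟨n, e f⟩.
have proj (x : 'cV[R]_d.+1) : ⟨x - ⟨x, e f⟩ *: e f, e f⟩ = 0.
  by rewrite !lorentzL unit_e mulr1 subrr.
have [l0|l0] := leP 0 l.
  have [x [_ xh xo]] := inner_point_exists h.
  exists (x - ⟨x, e f⟩ *: e f); rewrite // lorentzDl lorentzNl lorentzZl (lorentzC (e f)) -/l.
  rewrite /n !lorentzL xh mulr0 add0r gt_eqF //.
  have := xo _ fh; have /(xo _) : k <> h by move/esym.
  move=> xk xf; have : 0 < - (⟨q, e h⟩ * ⟨x, e k⟩) by rewrite oppr_gt0 pmulr_rlt0.
  have : 0 <= - (⟨x, e f⟩ * l) by rewrite oppr_ge0 mulr_le0_ge0 // ltW.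
  lra.
have [x [_ xk xo]] := inner_point_exists k.
exists (x - ⟨x, e f⟩ *: e f); rewrite // lorentzDl lorentzNl lorentzZl (lorentzC (e f)) -/l.
rewrite /n !lorentzL xk mulr0 subr0 lt_eqF //.
have := xo _ fk; have := xo _ hk.
move=> xh xf; have : ⟨q, e k⟩ * ⟨x, e h⟩ < 0 by rewrite pmulr_rlt0.
have : 0 < ⟨x, e f⟩ * l by rewrite nmulr_rgt0.
lra.
Qed.

(** The conditions say that the ray from the inner point [x] in direction [q]
    meets the hyperplanes of distinct faces at distinct times. Each of them
    excludes the points of one hyperplane, which does not contain the face by
    [not_tangent_pencil]. *)
Lemma generic_inner_point f (q : 'cV[R]_d.+1) (s : seq (F * F)) :
  exists2 x, inner_point f x & forall p, p \in s ->
    f <> p.1 -> f <> p.2 -> p.1 <> p.2 -> 0 < ⟨q, e p.1⟩ -> 0 < ⟨q, e p.2⟩ ->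
    ⟨x, e p.1⟩ * ⟨q, e p.2⟩ != ⟨x, e p.2⟩ * ⟨q, e p.1⟩.
Proof.
elim: s => [|p s [x [fx xf xo] IH]].
  by have [x fx] := inner_point_exists f; exists x.
have [[c1 [c2 [c3 [c4 c5]]]]|nc] := pselect (f <> p.1 /\ f <> p.2 /\ p.1 <> p.2 /\
    0 < ⟨q, e p.1⟩ /\ 0 < ⟨q, e p.2⟩); last first.
  exists x => // p'; rewrite inE => /predU1P[->|/IH //].
  by move=> *; exfalso; apply: nc.
have [v vf vn] := not_tangent_pencil c1 c2 c3 c4 c5.
pose ok s := [/\ future (x + s *: v), forall h, h <> f -> ⟨x + s *: v, e h⟩ < 0
  , ⟨x, e p.1⟩ * ⟨q, e p.2⟩ - ⟨x, e p.2⟩ * ⟨q, e p.1⟩ +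
    s * ⟨v, ⟨q, e p.2⟩ *: e p.1 - ⟨q, e p.1⟩ *: e p.2⟩ != 0
  & forall p' : F * F, ⟨x, e p'.1⟩ * ⟨q, e p'.2⟩ != ⟨x, e p'.2⟩ * ⟨q, e p'.1⟩ ->
    ⟨x, e p'.1⟩ * ⟨q, e p'.2⟩ - ⟨x, e p'.2⟩ * ⟨q, e p'.1⟩ +
    s * (⟨v, e p'.1⟩ * ⟨q, e p'.2⟩ - ⟨v, e p'.2⟩ * ⟨q, e p'.1⟩) != 0].
have : for_small ok.
  have s1 := for_small_quad (2 * ⟨x, v⟩) ⟨v, v⟩ fx.1.
  have s2 : for_small (fun s => - x ord0 ord0 + s * (- v ord0 ord0) < 0).
    by apply: for_small_lin; rewrite oppr_lt0; case: fx.
  have s3 : for_small (fun s => forall h : F, h <> f -> ⟨x, e h⟩ + s * ⟨v, e h⟩ < 0).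
    apply: for_small_forall => h; have [->|hf] := pselect (h = f); first by exists 1.
    have [a a0 ha] := for_small_lin ⟨v, e h⟩ (xo _ hf).
    by exists a => // t /ha.
  have s4 : for_small (fun s => ⟨x, e p.1⟩ * ⟨q, e p.2⟩ - ⟨x, e p.2⟩ * ⟨q, e p.1⟩ +
    s * ⟨v, ⟨q, e p.2⟩ *: e p.1 - ⟨q, e p.1⟩ *: e p.2⟩ != 0).
    by apply: for_small_neq0; rewrite vn orbT.
  have s5 : for_small (fun s => forall p' : F * F,
    ⟨x, e p'.1⟩ * ⟨q, e p'.2⟩ != ⟨x, e p'.2⟩ * ⟨q, e p'.1⟩ ->
    ⟨x, e p'.1⟩ * ⟨q, e p'.2⟩ - ⟨x, e p'.2⟩ * ⟨q, e p'.1⟩ +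
    s * (⟨v, e p'.1⟩ * ⟨q, e p'.2⟩ - ⟨v, e p'.2⟩ * ⟨q, e p'.1⟩) != 0).
    apply: for_small_forall => p'.
    have [->|hp] := eqVneq (⟨x, e p'.1⟩ * ⟨q, e p'.2⟩) (⟨x, e p'.2⟩ * ⟨q, e p'.1⟩).
      by exists 1.
    have [|a a0 ha] := @for_small_neq0 _ (⟨x, e p'.1⟩ * ⟨q, e p'.2⟩ - ⟨x, e p'.2⟩ * ⟨q, e p'.1⟩)
      (⟨v, e p'.1⟩ * ⟨q, e p'.2⟩ - ⟨v, e p'.2⟩ * ⟨q, e p'.1⟩); first by rewrite subr_eq0 hp.
    by exists a => // t /ha.
  have [a a0 ha] := for_small_and s1 (for_small_and s2 (for_small_and s3 (for_small_and s4 s5))).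
  exists a => // t /ha[h1 [h2 [h3 [h4 h5]]]]; split=> //.
    split; last by rewrite !mxE; lra.
    by rewrite !lorentzL (lorentzC v x); move: h1; lra.
  by move=> h /h3; rewrite !lorentzL.
case/for_small_ex => t t0 [h1 h2 h3 h4]; exists (x + t *: v).
  by split=> //; rewrite !lorentzL xf vf; ring.
have E p' : ⟨x + t *: v, e p'.1⟩ * ⟨q, e p'.2⟩ - ⟨x + t *: v, e p'.2⟩ * ⟨q, e p'.1⟩
  = ⟨x, e p'.1⟩ * ⟨q, e p'.2⟩ - ⟨x, e p'.2⟩ * ⟨q, e p'.1⟩ +
    t * (⟨v, e p'.1⟩ * ⟨q, e p'.2⟩ - ⟨v, e p'.2⟩ * ⟨q, e p'.1⟩).
  by rewrite !lorentzL; ring.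
move=> p'; rewrite inE => /predU1P[-> _ _ _ _ _|/IH h' *]; rewrite -subr_eq0 E.
  by move: h3; rewrite !lorentzL; congr (_ != _); ring.
exact/h4/h'.
Qed.

(** If the projection of a point of the polyhedron to the hyperplane of [f] left
    the face [f], then a generic segment to it from an inner point of the face
    would leave the face through an inner point of an edge. The second face
    along this edge is orthogonal to [f], so the projection does not change the
    product with its normal, which is a contradiction. *)
Lemma face_projection f x h : polyhedron e x -> ⟨x - ⟨x, e f⟩ *: e f, e h⟩ <= 0.
Proof.
move=> [hx Px]; set q := _ - _; rewrite leNgt; apply/negP => qh0.
have fq : future q.
  apply: (future_of_lt0 (hyperboloid_future hx)); rewrite /q !lorentzL.
    have : 0 <= ⟨x, e f⟩ ^+ 2 by rewrite sqr_ge0.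
    by rewrite unit_e (lorentzC (e f) x) hx.1 expr2; lra.
  have : 0 <= ⟨x, e f⟩ ^+ 2 by rewrite sqr_ge0.
  by rewrite hx.1 expr2; lra.
have qf : ⟨q, e f⟩ = 0 by rewrite /q !lorentzL unit_e; ring.
have [y [fy yf yo] ygen] := generic_inner_point f q (enum {: F * F}).
(* r k is the time at which the ray y + s *: q meets the hyperplane of k *)
pose r k := - ⟨y, e k⟩ / ⟨q, e k⟩.
case: (@arg_minP _ _ _ h (fun k => 0 < ⟨q, e k⟩) r qh0) => k qk kmin.
have kf : f <> k by move=> fk; move: qk; rewrite -fk qf ltxx.
have rk0 : 0 < r k.
  by rewrite divr_gt0 // oppr_gt0 yo // => /esym.
pose z := y + r k *: q.
have zk : ⟨z, e k⟩ = 0 by rewrite /z lorentzDl lorentzZl /r; field; rewrite gt_eqF.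
have zf : ⟨z, e f⟩ = 0 by rewrite /z lorentzDl lorentzZl yf qf; ring.
have : share_edge e f k.
  apply: (@share_edge_witness f k z) => //; first exact/futureD/futureZ.
  move=> j jf jk; have yj := yo _ jf; rewrite /z lorentzDl lorentzZl.
  have [qj|qj] := ltP 0 ⟨q, e j⟩; last first.
    have : r k * ⟨q, e j⟩ <= 0 by rewrite pmulr_rle0.
    lra.
  have rjk : r k < r j.
    rewrite lt_neqAle kmin // andbT.
    have := ygen (k, j); rewrite mem_enum => /(_ isT kf) /=.
    move=> /(_ (fun E => jf (esym E)) (fun E => jk (esym E)) qk qj).
    apply: contraNneq; rewrite /r => E.
    by move/eqP: E; rewrite eqr_div ?(gt_eqF qk) ?(gt_eqF qj) // !mulNr eqr_opp.
  have : r k * ⟨q, e j⟩ < r j * ⟨q, e j⟩ by rewrite ltr_pM2r.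
  by rewrite /r divfK ?gt_eqF //; move: (r k * _) => *; lra.
move/right_angled => fk0; have := Px k.
by move: qk; rewrite /q !lorentzL fk0; lra.
Qed.

(** Project an inner point of [g] to the hyperplane of [f]. *)
Lemma acute f g : f <> g -> ⟨e f, e g⟩ <= 0.
Proof.
move=> fg; have [x [fx xg xo]] := inner_point_exists g.
have Px : polyhedron e (normalize x).
  split=> [|h]; first exact: normalize_hyperboloid.
  rewrite lorentzL pmulr_rle0 ?normalize_coef //.
  by have [->|/xo/ltW//] := pselect (h = g); rewrite xg.
have := face_projection f g Px.
rewrite !lorentzL xg mulr0 add0r.
have : (Num.sqrt (- ⟨x, x⟩))^-1 * ⟨x, e f⟩ < 0 by rewrite pmulr_rlt0 ?normalize_coef ?xo.
by move=> h; rewrite -mulNr pmulr_rle0 // oppr_gt0.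
Qed.

(** For intersecting hyperplanes, the projection of an inner point to their
    intersection stays in the polyhedron because the angles are acute, so the
    faces meet along an edge; hyperplanes that meet at infinity would make the
    polyhedron unbounded. *)
Lemma nonadjacent_ultraparallel f g : f <> g -> ~ share_edge e f g -> ⟨e f, e g⟩ < -1.
Proof.
move=> fg nshare; rewrite ltNge; apply/negP => c1.
have [_ _ [x0 [hx0 x0e]] _] := compact_e.
have c0 := acute fg; set c := - ⟨e f, e g⟩.
set a := - ⟨x0, e f⟩; set b := - ⟨x0, e g⟩.
have a0 : 0 < a by rewrite oppr_gt0.
have b0 : 0 < b by rewrite oppr_gt0.
have [cE|cn1] := eqVneq c 1.
  have [B hB] := polyhedron_lorentz_bound.
  (* the distance from x0 to the normalization of z tends to infinity with s *)
  have zz (s : R) : 0 < s -> (1 + s * (a + b)) ^+ 2 <= B ^+ 2 * (1 + 2 * s * (a + b)).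
    move=> s0; pose z := x0 + s *: (e f + e g).
    have x0z : ⟨x0, z⟩ = - (1 + s * (a + b)) by rewrite /z !lorentzL hx0.1 /a /b; ring.
    have zzE : ⟨z, z⟩ = - (1 + 2 * s * (a + b)).
      rewrite /z !lorentzL hx0.1 !unit_e !(lorentzC _ x0) (lorentzC (e g)) /a /b.
      have -> : ⟨e f, e g⟩ = -1 by move: cE; rewrite /c; lra.
      by ring.
    have sab : 0 < s * (a + b) by rewrite mulr_gt0 // addr_gt0.
    have fz : future z.
      by apply: (future_of_lt0 (hyperboloid_future hx0)); rewrite ?x0z ?zzE; lra.
    have Pz : polyhedron e (normalize z).
      split=> [|h]; first exact: normalize_hyperboloid.
      rewrite lorentzL pmulr_rle0 ?normalize_coef // !lorentzL.
      suff : s * (⟨e f, e h⟩ + ⟨e g, e h⟩) <= 0 by have := x0e h; lra.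
      rewrite pmulr_rle0 //.
      have [->|hf] := pselect (h = f).
        by rewrite unit_e (lorentzC (e g)); move: cE; rewrite /c; lra.
      have [->|hg] := pselect (h = g); first by rewrite unit_e; move: cE; rewrite /c; lra.
      by have := acute (fun E => hf (esym E)); have := acute (fun E => hg (esym E)); lra.
    have Px0 : polyhedron e x0 by split=> // h; exact/ltW/x0e.
    have := hB _ _ Px0 Pz; rewrite /normalize lorentzZr x0z zzE !opprK.
    set w := 1 + 2 * s * (a + b).
    have w0 : 0 < w by rewrite /w; lra.
    have sw0 : 0 < Num.sqrt w by rewrite sqrtr_gt0.
    rewrite mulrN opprK mulrC ler_pdivrMr // => h.
    rewrite -[X in _ <= _ * X](sqr_sqrtr (ltW w0)) -exprMn ler_sqr ?nnegrE //; first lra.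
    by apply: le_trans h; lra.
  have ab0 : 0 < a + b by rewrite addr_gt0.
  have B0 : 0 <= B ^+ 2 by rewrite sqr_ge0.
  have := zz (2 * (B ^+ 2 + 1) / (a + b)).
  have -> : 2 * (2 * (B ^+ 2 + 1) / (a + b)) * (a + b) = 4 * (B ^+ 2 + 1) by field; rewrite gt_eqF.
  have -> : 2 * (B ^+ 2 + 1) / (a + b) * (a + b) = 2 * (B ^+ 2 + 1) by field; rewrite gt_eqF.
  rewrite divr_gt0 ?mulr_gt0 //; last by lra.
  move=> /(_ isT); move: (B ^+ 2) B0 => t t0.
  have : 0 <= t ^+ 2 by rewrite sqr_ge0.
  rewrite !expr2; lra.
have {cn1} c11 : c < 1 by rewrite lt_neqAle cn1 /c; lra.
have cc : 0 <= c by rewrite /c; lra.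
have D0 : 0 < 1 - c ^+ 2 by rewrite subr_gt0 expr_lt1.
(* z is the projection of x0 to the intersection of the two hyperplanes *)
apply: nshare; pose al := (a + c * b) / (1 - c ^+ 2); pose be := (b + c * a) / (1 - c ^+ 2).
have al0 : 0 < al by rewrite divr_gt0 // ltr_wpDr // mulr_ge0 // ltW.
have be0 : 0 < be by rewrite divr_gt0 // ltr_wpDr // mulr_ge0 // ltW.
pose z := x0 + al *: e f + be *: e g.
have efg : ⟨e f, e g⟩ = - c by rewrite /c opprK.
have x0f : ⟨x0, e f⟩ = - a by rewrite /a opprK.
have x0g : ⟨x0, e g⟩ = - b by rewrite /b opprK.
have zf : ⟨z, e f⟩ = 0.
  rewrite /z !lorentzL unit_e (lorentzC (e g)) efg x0f /al /be; field.
  by rewrite gt_eqF.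
have zg : ⟨z, e g⟩ = 0.
  rewrite /z !lorentzL unit_e efg x0g /al /be; field.
  by rewrite gt_eqF.
have zx0 : ⟨x0, z⟩ = - 1 - al * a - be * b.
  by rewrite /z !lorentzL hx0.1 x0f x0g; ring.
have zz : ⟨z, z⟩ = ⟨x0, z⟩.
  by rewrite {1}/z !lorentzDl !lorentzZl -[⟨e f, z⟩]lorentzC -[⟨e g, z⟩]lorentzC zf zg; ring.
have aa : 0 < al * a by rewrite mulr_gt0.
have bb : 0 < be * b by rewrite mulr_gt0.
apply: (@share_edge_witness f g z) => //.
  by apply: (future_of_lt0 (hyperboloid_future hx0)); rewrite ?zz zx0; lra.
move=> h hf hg; rewrite /z !lorentzL.
have : al * ⟨e f, e h⟩ <= 0 by rewrite pmulr_rle0 // acute // => /esym.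
have : be * ⟨e g, e h⟩ <= 0 by rewrite pmulr_rle0 // acute // => /esym.
by have := x0e h; lra.
Qed.

End AcutePolyhedra.

(** * Reflection groups of right-angled systems *)

Section RightAngledSystem.
Context {R : realType} {d : nat} {F : finType}.
Variable e : F -> 'cV[R]_d.+1.
Implicit Types (f s t u : F) (v w : seq F) (x y : 'cV[R]_d.+1).

Definition right_angled_system :=
  (forall f, ⟨e f, e f⟩ = 1) /\
  (forall f g, f != g -> ⟨e f, e g⟩ = 0 \/ ⟨e f, e g⟩ < -1).

Hypothesis ras : right_angled_system.

Let unit_e f : ⟨e f, e f⟩ = 1. Proof. exact: ras.1. Qed.

Let le0 f g : f != g -> ⟨e f, e g⟩ <= 0.
Proof. by case/ras.2 => [->//|h]; apply: le_trans (ltW h) _; rewrite oppr_le0. Qed.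

Definition word_mx (w : seq F) : 'M[R]_d.+1 :=
  foldr (fun t g => reflection (e t) * g) 1 w.

Lemma word_mx_cons t w x : word_mx (t :: w) *m x = reflection (e t) *m (word_mx w *m x).
Proof. by rewrite mulmxA. Qed.

Lemma word_mx_cat v w : word_mx (v ++ w) = word_mx v * word_mx w.
Proof. by elim: v => [|t v IH] /=; rewrite ?mul1r // IH mulrA. Qed.

Lemma word_mx_lorentz w : preserves_lorentz (word_mx w).
Proof.
elim: w => [|t w IH] x y; first by rewrite !mul1mx.
by rewrite !word_mx_cons reflection_lorentz.
Qed.

Lemma word_mx_rev w : word_mx (rev w) * word_mx w = 1.
Proof.
elim: w => [|t w IH] /=; first by rewrite mulr1.
rewrite rev_cons -cats1 word_mx_cat /= mulr1 -mulrA (mulrA (reflection _)).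
by rewrite reflection_sq // mul1r.
Qed.

Lemma word_mx_unit w : word_mx w \is a GRing.unit.
Proof.
apply/unitrP; exists (word_mx (rev w)); rewrite word_mx_rev; split=> //.
by rewrite -{1}[w]revK word_mx_rev.
Qed.

Lemma word_mxV w : (word_mx w)^-1 = word_mx (rev w).
Proof. by apply: (mulIr (word_mx_unit w)); rewrite mulVr ?word_mx_unit // word_mx_rev. Qed.

Lemma word_mx_future w x : future x -> future (word_mx w *m x).
Proof.
elim: w => [|t w IH] fx; first by rewrite mul1mx.
by rewrite word_mx_cons; apply: reflection_future => //; apply: IH.
Qed.

Lemma word_mx_hyperboloid w x : hyperboloid x -> hyperboloid (word_mx w *m x).
Proof.
move=> hx; split; first by rewrite word_mx_lorentz hx.1.
by case: (word_mx_future w (hyperboloid_future hx)).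
Qed.

Lemma word_mx_adjoint w x y : ⟨word_mx (rev w) *m x, y⟩ = ⟨x, word_mx w *m y⟩.
Proof.
rewrite -(word_mx_lorentz w) mulmxA -{1}[w]revK.
by rewrite (word_mx_rev (rev w) : word_mx _ *m _ = _) mul1mx.
Qed.

Lemma reflection_group_word g : reflection_group e g <-> exists w, g = word_mx w.
Proof.
split=> [|[w ->] G [G1 GM _] sG]; last first.
  by elim: w => [|t w IH] //=; apply: GM => //; apply: sG; exists t.
move/(_ (fun g => exists w, g = word_mx w)); apply=> [|_ [f _ <-]]; last first.
  by exists [:: f]; rewrite /= mulr1.
split; first by exists [::].
  by move=> _ _ [v ->] [w ->]; exists (v ++ w); rewrite word_mx_cat.
by move=> _ [w ->]; exists (rev w); rewrite word_mxV.
Qed.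

(** ** Climbing words

  The letters of a climbing word act from right to left, and every letter [t]
  moves a vector from the negative side of the mirror of [t] to the positive
  one. Climbing words replace reduced words of the Coxeter group. *)

Fixpoint climbing (y : 'cV[R]_d.+1) (w : seq F) : Prop :=
  if w is t :: w' then climbing y w' /\ ⟨word_mx w' *m y, e t⟩ < 0 else True.

(** A vector beyond the mirror of [s] is even farther in front of every mirror
    disjoint from that of [s]. *)
Definition dominated (y : 'cV[R]_d.+1) := forall s u,
  ⟨e s, e u⟩ < -1 -> 0 < ⟨y, e s⟩ -> ⟨y, e u⟩ <= ⟨e s, e u⟩ * ⟨y, e s⟩.

Lemma reflection_same t y : ⟨reflection (e t) *m y, e t⟩ = - ⟨y, e t⟩.
Proof. by rewrite reflectionE !lorentzL unit_e; ring. Qed.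

Lemma reflection_orth t s y : ⟨e t, e s⟩ = 0 -> ⟨reflection (e t) *m y, e s⟩ = ⟨y, e s⟩.
Proof. by rewrite reflectionE !lorentzL => ->; ring. Qed.

(** With [C = - ⟨e t, e s⟩] and [A = - ⟨y, e t⟩], domination gives
    [C * ⟨y, e s⟩ <= A], so the product [⟨y, e s⟩ - 2 * A * C] after the reflection
    is at most [- A * (2 * C ^+ 2 - 1) / C]. *)
Lemma climb_bound t s y : dominated y -> ⟨y, e t⟩ < 0 -> ⟨e t, e s⟩ < -1 ->
  - ⟨y, e t⟩ * (2 * ⟨e t, e s⟩ ^+ 2 - 1) <= ⟨e t, e s⟩ * ⟨reflection (e t) *m y, e s⟩.
Proof.
move=> dy yt ts; rewrite reflectionE !lorentzL.
suff : ⟨y, e t⟩ <= ⟨e t, e s⟩ * ⟨y, e s⟩ by move: (⟨e t, e s⟩) => c; lra.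
have [ys|ys] := ltP 0 ⟨y, e s⟩.
  by rewrite (lorentzC (e t)); apply: dy => //; rewrite lorentzC.
by apply: le_trans (ltW yt) _; rewrite mulr_le0 //; lra.
Qed.

Lemma climb_le t s y : dominated y -> ⟨y, e t⟩ < 0 -> ⟨e t, e s⟩ < -1 ->
  ⟨reflection (e t) *m y, e s⟩ <= ⟨y, e t⟩.
Proof.
move=> dy yt ts; have := climb_bound dy yt ts.
move: (⟨e t, e s⟩) (⟨y, e t⟩) (⟨reflection _ *m y, e s⟩) yt ts => c a b a0 c1 h.
rewrite -(ler_nM2l (_ : c < 0)); last by lra.
apply: le_trans h; rewrite -subr_ge0.
have -> : - a * (2 * c ^+ 2 - 1) - c * a = (- a) * ((2 * c - 1) * (c + 1)) by ring.
by apply: mulr_ge0; [lra|apply: mulr_le0; lra].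
Qed.

Lemma climb_lt0 t s y : dominated y -> ⟨y, e t⟩ < 0 -> ⟨e t, e s⟩ < -1 ->
  ⟨reflection (e t) *m y, e s⟩ < 0.
Proof. by move=> dy yt ts; apply: le_lt_trans (climb_le dy yt ts) yt. Qed.

Lemma dominated_step t y : dominated y -> ⟨y, e t⟩ < 0 -> dominated (reflection (e t) *m y).
Proof.
move=> dy yt s u su.
have [ts|ts] := eqVneq t s.
  rewrite -ts in su *; move=> _; rewrite reflection_same.
  have := climb_bound dy yt su.
  move: (⟨e t, e u⟩) (⟨y, e t⟩) (⟨reflection _ *m y, e u⟩) yt su => c a b a0 c1 h.
  rewrite -(ler_nM2l (_ : c < 0)); last by lra.
  apply: le_trans h; rewrite -subr_ge0.
  have -> : - a * (2 * c ^+ 2 - 1) - c * (c * - a) = (- a) * ((c - 1) * (c + 1)) by ring.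
  by apply: mulr_ge0; [lra|apply: mulr_le0; lra].
have [ts0|ts1] := ras.2 _ _ ts; last first.
  by rewrite ltNge ltW // climb_lt0.
rewrite reflection_orth // => ys; apply: le_trans (dy _ _ su ys).
have [tu|tu] := eqVneq t u; first by move: su; rewrite -tu (lorentzC (e s)) ts0; lra.
rewrite reflectionE !lorentzL gerBl -mulrA pmulr_rge0 //.
by apply: mulr_le0; [exact: ltW|exact: le0].
Qed.

Lemma climbing_dominated y w : dominated y -> climbing y w -> dominated (word_mx w *m y).
Proof.
move=> dy; elim: w => [|t w IH] /=; first by rewrite mul1mx.
by case=> /IH dw wt; rewrite -mulmxA; apply: dominated_step.
Qed.

Lemma reflections_commute s t y : ⟨e s, e t⟩ = 0 ->
  reflection (e s) *m (reflection (e t) *m y) = reflection (e t) *m (reflection (e s) *m y).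
Proof.
move=> st; rewrite !reflectionE !lorentzL st (lorentzC (e t)) st !mulr0 !subr0.
by rewrite addrAC.
Qed.

(** ** Roots *)

Lemma dominated_root f : dominated (e f).
Proof.
move=> s u su fs; have [fsE|fs'] := eqVneq f s; first by rewrite fsE unit_e mulr1.
by have := le0 fs'; rewrite leNgt fs.
Qed.

(** The letter [t] can be prepended unless it moves the root back. If it cancels
    the first letter [s], then [s] is deleted; otherwise [t] commutes with [s],
    since climbing past a disjoint mirror leaves the root in front of it, and
    induction applies behind [s]. *)
Lemma climbing_root_step f w t : climbing (e f) w ->
  (exists2 w', climbing (e f) w' & word_mx w' *m e f = reflection (e t) *m (word_mx w *m e f))
  \/ word_mx w *m e f = e t.
Proof.
elim: w t => [|s w IH] t cw.
  rewrite mul1mx; have [->|ft] := eqVneq f t; [by right|left].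
  case: (ras.2 _ _ ft) => [ft0|ft1].
    by exists [::] => //; rewrite mul1mx reflectionE ft0 mulr0 scale0r subr0.
  exists [:: t]; last by rewrite /= mulr1.
  by split=> //; rewrite mul1mx; lra.
have [cw1 ws] := cw; have dw := climbing_dominated (@dominated_root f) cw1.
rewrite word_mx_cons; set y := word_mx w *m e f in ws dw *.
case: (ltrgtP ⟨reflection (e s) *m y, e t⟩ 0) => yt.
- by left; exists (t :: s :: w); rewrite ?word_mx_cons //; split=> //; rewrite word_mx_cons.
- have [st|st] := eqVneq s t.
    left; exists w => //; rewrite -st mulmxA (reflection_sq (unit_e s) : _ *m _ = _).
    by rewrite mul1mx.
  have [st0|st1] := ras.2 _ _ st; last first.
    by have := climb_lt0 dw ws st1; rewrite ltNge ltW.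
  rewrite reflection_orth // in yt.
  case: (IH t cw1) => [[w' cw' E]|E]; last first.
    by move: ws; rewrite /y E lorentzC st0 ltxx.
  left; exists (s :: w'); last by rewrite word_mx_cons E reflections_commute.
  by split=> //; rewrite E reflection_orth // lorentzC.
- by left; exists (s :: w); rewrite ?word_mx_cons // [RHS]reflectionE yt mulr0 scale0r subr0.
Qed.

Lemma root_climbing v f : exists2 w, climbing (e f) w &
  word_mx v *m e f = word_mx w *m e f \/ word_mx v *m e f = - (word_mx w *m e f).
Proof.
elim: v => [|t v [w cw wE]]; first by exists [::] => //; left.
rewrite word_mx_cons; case: (climbing_root_step t cw) => [[w' cw' E]|E].
  exists w' => //; rewrite E; case: wE => ->; [by left|right].
  by rewrite mulmxN.
exists w => //; have rt : reflection (e t) *m e t = - e t.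
  by rewrite reflectionE unit_e mulr1 scaler_nat mulr2n opprD addNKr.
by case: wE => ->; rewrite ?mulmxN E rt; [right|left; rewrite opprK].
Qed.

(** Climbing adds nonnegative multiples of the normals to a root. *)
Lemma climbing_root_le0 f w x : (forall h, ⟨x, e h⟩ <= 0) -> climbing (e f) w ->
  ⟨x, word_mx w *m e f⟩ <= ⟨x, e f⟩.
Proof.
move=> Px; elim: w => [|t w IH]; first by rewrite mul1mx.
case=> /IH h wt; rewrite word_mx_cons reflectionE !lorentzL.
suff : 0 <= ⟨word_mx w *m e f, e t⟩ * ⟨x, e t⟩ by lra.
by rewrite mulr_le0 // ltW.
Qed.

(** A path from the mirror of [f] to the mirror of another root of type [f]
    leaves the first chamber through a face disjoint from [f], and likewise
    enters the last chamber. If the disjoint faces are at distance at least [r]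
    from [f], where [cosh r = m], then the distance of the mirrors is at least
    [2 * r], and [cosh (2 * r) = 2 * m ^+ 2 - 1]. *)
Section RootDistance.
Variables (f : F) (m : R).
Hypotheses (m1 : 1 <= m).
Hypothesis mf : forall h, ⟨e f, e h⟩ < -1 -> ⟨e f, e h⟩ <= - m.

Lemma climbing_root_sep w s : climbing (e f) w -> ⟨word_mx w *m e f, e s⟩ < 0 ->
  ⟨word_mx w *m e f, e s⟩ <= - (if s == f then 1 else m).
Proof.
elim: w s => [|t w IH] s.
  move=> _; rewrite mul1mx => fs.
  have [sf|sf] := eqVneq s f; first by move: fs; rewrite sf unit_e; lra.
  have fs' : f != s by rewrite eq_sym.
  by apply: mf; case: (ras.2 _ _ fs') => // fs0; move: fs; rewrite fs0 ltxx.
case=> cw wt; have dw := climbing_dominated (@dominated_root f) cw.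
rewrite word_mx_cons; set y := word_mx w *m e f in wt dw *.
have := IH t cw wt; rewrite -/y => yt.
have [ts|ts] := eqVneq t s; first by rewrite -ts reflection_same; lra.
have [ts0|ts1] := ras.2 _ _ ts; first by rewrite reflection_orth //; apply: IH.
move=> _; have := climb_le dw wt ts1.
have [tf|tf] := eqVneq t f; last first.
  by move: yt; rewrite (negPf tf); case: ifP => _ h1 h2; apply: le_trans h2 (le_trans h1 _); rewrite lerN2.
rewrite -tf eq_sym (negPf ts) => _; have := climb_bound dw wt ts1.
have := mf (h := s); rewrite -tf => /(_ ts1).
move: yt; rewrite tf eqxx -tf.
move: (⟨e t, e s⟩) (⟨y, e t⟩) (⟨reflection _ *m y, e s⟩) ts1 => c a b c1 a1 cm h.
suff : b <= c by lra.
rewrite -(ler_nM2l (_ : c < 0)); last by lra.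
apply: le_trans h; rewrite -subr_ge0.
have -> : - a * (2 * c ^+ 2 - 1) - c * c = (- a - 1) * (2 * c ^+ 2 - 1) + (c - 1) * (c + 1) by ring.
have c2 : 0 <= (c - 1) * (c + 1) by apply: mulr_le0; lra.
apply: addr_ge0 => //; apply: mulr_ge0; first by lra.
by move: c2; rewrite expr2; lra.
Qed.

Lemma climbing_root_far w : climbing (e f) w ->
  word_mx w *m e f = e f \/ 2 * m ^+ 2 - 1 <= `|⟨word_mx w *m e f, e f⟩|.
Proof.
elim: w => [|t w IH]; first by left; rewrite mul1mx.
case=> cw wt; have dw := climbing_dominated (@dominated_root f) cw.
have := climbing_root_sep cw wt.
rewrite word_mx_cons; set y := word_mx w *m e f in wt dw *.
have {}IH := IH cw; rewrite -/y in IH => yt; right.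
have [tf|tf] := eqVneq t f.
  rewrite tf in wt *; rewrite reflection_same normrN; case: IH => // E.
  by move: wt; rewrite E unit_e; lra.
have [tf0|tf1] := ras.2 _ _ tf.
  rewrite reflection_orth //; case: IH => // E.
  by move: wt; rewrite E lorentzC tf0 ltxx.
have := climb_bound dw wt tf1; have := mf (h := t); rewrite (lorentzC (e f)) => /(_ tf1).
move: yt; rewrite (negPf tf).
move: (⟨e t, e f⟩) (⟨y, e t⟩) (⟨reflection _ *m y, e f⟩) tf1 => c a b c1 am cm h.
suff : b <= - (2 * m ^+ 2 - 1) by move=> hb; rewrite -normrN; apply: le_trans (ler_norm _); lra.
rewrite -(ler_nM2l (_ : c < 0)); last by lra.
apply: le_trans h; rewrite -subr_ge0.
have -> : - a * (2 * c ^+ 2 - 1) - c * - (2 * m ^+ 2 - 1) =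
  (- a - m) * (2 * c ^+ 2 - 1) + (m + c) * (2 * c * m - 1) by ring.
have c2 : 0 <= (c - 1) * (c + 1) by apply: mulr_le0; lra.
apply: addr_ge0.
  by apply: mulr_ge0; [lra|move: c2; rewrite expr2; lra].
apply: mulr_le0; first by lra.
have m0 : 0 <= m by apply: le_trans m1.
have : c * m <= 0 by apply: mulr_le0_ge0 => //; lra.
by lra.
Qed.

End RootDistance.
End RightAngledSystem.

(** * Chambers *)

Section Chambers.
Context {R : realType} {d : nat} {F : finType}.
Variable e : F -> 'cV[R]_d.+1.
Hypothesis ras : right_angled_system e.
Variable x0 : 'cV[R]_d.+1.
Hypothesis hx0 : hyperboloid x0.
Hypothesis x0e : forall f, ⟨x0, e f⟩ < 0.
Implicit Types (f s t u : F) (v w : seq F) (x y : 'cV[R]_d.+1).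

Let unit_e f : ⟨e f, e f⟩ = 1. Proof. exact: ras.1. Qed.

Let dominated_x0 : dominated e x0.
Proof. by move=> s u _; rewrite ltNge ltW. Qed.

Lemma climbing_chamber_neq0 w t : climbing e x0 w -> ⟨word_mx e w *m x0, e t⟩ != 0.
Proof.
elim: w t => [|s w IH] t; first by rewrite mul1mx lt_eqF.
case=> cw ws; have dw := climbing_dominated ras dominated_x0 cw.
rewrite word_mx_cons; have [<-|st] := eqVneq s t.
  by rewrite reflection_same // oppr_eq0 lt_eqF.
have [st0|st1] := ras.2 _ _ st; first by rewrite reflection_orth // IH.
by rewrite lt_eqF // climb_lt0.
Qed.

(** ** The sum of the colors of the letters of a word *)

Section Colors.
Variables (V : zmodType) (col : F -> V).
Hypothesis col2 : forall c : V, c + c = 0.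

Definition word_color w : V := \sum_(t <- w) col t.

Lemma word_color_cons t w : word_color (t :: w) = col t + word_color w.
Proof. by rewrite /word_color big_cons. Qed.

Lemma word_color_cat v w : word_color (v ++ w) = word_color v + word_color w.
Proof. by rewrite /word_color big_cat. Qed.

Lemma word_color_rev w : word_color (rev w) = word_color w.
Proof. by rewrite /word_color (perm_big w) // perm_rev. Qed.

(** The cancellation argument of [climbing_root_step]; colors are preserved
    because deleted letters come in pairs. *)
Lemma climbing_chamber_step w t : climbing e x0 w -> exists w', [/\ climbing e x0 w',
  word_mx e w' = reflection (e t) * word_mx e w & word_color w' = col t + word_color w].
Proof.
elim: w t => [|s w IH] t cw.
  exists [:: t]; split; rewrite ?word_color_cons //.
  by split=> //; rewrite mul1mx.
have [cw1 ws] := cw; have dw := climbing_dominated ras dominated_x0 cw1.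
case: (ltrgtP ⟨word_mx e (s :: w) *m x0, e t⟩ 0) => yt.
- by exists (t :: s :: w); split=> //; rewrite !word_color_cons.
- have [st|st] := eqVneq s t.
    exists w; split=> //; first by rewrite -st /= mulrA reflection_sq ?mul1r.
    by rewrite word_color_cons st addrA col2 add0r.
  have [st0|st1] := ras.2 _ _ st; last first.
    by have := climb_lt0 dw ws st1; rewrite -word_mx_cons ltNge ltW.
  case: (IH t cw1) => w' [cw' E Ec]; exists (s :: w'); split.
  + split=> //; rewrite E -[_ * _]/(_ *m _) -mulmxA reflection_orth //.
    by rewrite lorentzC.
  + apply: mulmx_ext => x; rewrite /= E -[X in X *m x]/(_ *m (_ *m _)) -!mulmxA.
    by rewrite reflections_commute // -!mulmxA.
  + by rewrite !word_color_cons Ec addrCA.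
- by have := climbing_chamber_neq0 t cw; rewrite yt eqxx.
Qed.

Lemma climbing_chamber v : exists w,
  [/\ climbing e x0 w, word_mx e w = word_mx e v & word_color w = word_color v].
Proof.
elim: v => [|t v [w [cw E Ec]]]; first by exists [::].
case: (climbing_chamber_step t cw) => w' [cw' E' Ec']; exists w'; split=> //.
  by rewrite E' E.
by rewrite Ec' Ec word_color_cons.
Qed.

(** A nonempty climbing word moves the interior point [x0] out of the chamber, so
    the climbing form of a relation is the empty word. *)
Lemma word_color_relation w : word_mx e w = 1 -> word_color w = 0.
Proof.
have [[|t v] [cv <- <-]] := climbing_chamber w; first by rewrite /word_color big_nil.
move=> E; exfalso; case: (cv) => _ vt; have := x0e t.
have -> : x0 = word_mx e (t :: v) *m x0 by rewrite E mul1mx.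
by rewrite word_mx_cons reflection_same //; lra.
Qed.

Lemma word_color_inj v w : word_mx e v = word_mx e w -> word_color v = word_color w.
Proof.
move=> vw; have : word_color (rev v ++ w) = 0.
  by apply: word_color_relation; rewrite word_mx_cat -vw word_mx_rev.
by rewrite word_color_cat word_color_rev => /(congr1 (+%R (word_color v)));
  rewrite addrA col2 add0r addr0.
Qed.

End Colors.

(** ** Stabilizers *)

(** For a climbing word [t :: w] that fixes [x], the product of the root
    [word_mx e (rev w) *m e t] with [x0] is negative, so its product with [x] is
    not positive; but this product is [⟨word_mx e w *m x, e t⟩ = - ⟨x, e t⟩], which
    is not negative. *)
Lemma climbing_stabilizer w x : (forall h, ⟨x, e h⟩ <= 0) ->
  climbing e x0 w -> word_mx e w *m x = x -> forall t, t \in w -> ⟨x, e t⟩ = 0.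
Proof.
move=> Px; elim: w => [|t w IH] //= [cw wt]; rewrite -mulmxA => E.
have wx : word_mx e w *m x = reflection (e t) *m x.
  by rewrite -{2}E mulmxA (reflection_sq (unit_e t) : _ *m _ = _) mul1mx.
have [u cu uE] := root_climbing ras (rev w) t.
have ux y : (forall h, ⟨y, e h⟩ <= 0) -> ⟨y, word_mx e u *m e t⟩ <= ⟨y, e t⟩.
  by move=> Py; apply: climbing_root_le0.
have wtx y : ⟨y, word_mx e (rev w) *m e t⟩ = ⟨word_mx e w *m y, e t⟩.
  by rewrite -(word_mx_adjoint ras) revK.
have xt : ⟨x, e t⟩ = 0.
  apply/le_anti; rewrite Px /=.
  have : ⟨word_mx e w *m x, e t⟩ <= 0.
    case: uE => uE; first by rewrite -wtx uE; apply: le_trans (ux _ Px) _.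
    have /ux : forall h, ⟨x0, e h⟩ <= 0 by move=> h; exact: ltW.
    have := x0e t; have := wt; rewrite -wtx uE lorentzNr; lra.
  by rewrite wx reflection_same //; lra.
move=> s; rewrite inE => /predU1P[-> //|]; apply: IH => //.
by rewrite wx reflectionE xt mulr0 scale0r subr0.
Qed.

(** ** The translates of the polyhedron cover hyperbolic space *)

(** The Gram determinant of [y], [e f] and [e g] is not positive, because the
    components of the normals orthogonal to [y] span a definite subspace. *)
Lemma gram3_bound f g y : hyperboloid y -> ⟨e f, e g⟩ < -1 ->
  ⟨e f, e g⟩ ^+ 2 - 1 <= ⟨y, e f⟩ ^+ 2 + ⟨y, e g⟩ ^+ 2 - 2 * ⟨y, e f⟩ * ⟨y, e g⟩ * ⟨e f, e g⟩.
Proof.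
move=> hy fg; set a := ⟨y, e f⟩; set b := ⟨y, e g⟩; set c := ⟨e f, e g⟩ in fg *.
have ef : 0 <= ⟨e f + a *: y, e f + a *: y⟩.
  by apply: (@timelike_orth _ _ y); rewrite ?hy.1 ?ltrN10 // !lorentzL hy.1 -/a; ring.
have : ⟨e f + a *: y, e g + b *: y⟩ ^+ 2 <=
  ⟨e f + a *: y, e f + a *: y⟩ * ⟨e g + b *: y, e g + b *: y⟩.
  apply: (@orth_Cauchy _ _ y); rewrite ?hy.1 ?ltrN10 // !lorentzL hy.1 -/a -/b; ring.
rewrite !lorentzL !unit_e hy.1 !(lorentzC _ y) -/a -/b -/c; lra.
Qed.

(** Otherwise [⟨y, e g⟩] would lie between [2 * ⟨y, e f⟩ * ⟨e f, e g⟩] and [del],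
    where the quadratic inequality of [gram3_bound] fails. *)
Lemma reflect_thin f g y (del : R) : hyperboloid y -> ⟨e f, e g⟩ < -1 ->
  del ^+ 2 * (1 - ⟨e f, e g⟩) < - ⟨e f, e g⟩ - 1 -> 0 < del ->
  0 < ⟨y, e f⟩ <= del -> ⟨y, e g⟩ <= del ->
  ⟨y, e g⟩ - 2 * ⟨y, e f⟩ * ⟨e f, e g⟩ < 0.
Proof.
move=> hy fg dfg d0 /andP[a0 ad] bd; have := gram3_bound hy fg.
move: (⟨y, e f⟩) (⟨y, e g⟩) a0 ad bd => a b a0 ad bd.
set C := - ⟨e f, e g⟩; have -> : ⟨e f, e g⟩ = - C by rewrite opprK.
have C1 : 1 < C by rewrite /C; lra.
have {}dfg : del ^+ 2 * (1 + C) < C - 1 by move: dfg; rewrite /C; lra.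
move=> q; rewrite ltNge; apply/negP => h.
have ad2 : a ^+ 2 <= del ^+ 2 by rewrite ler_sqr ?nnegrE //; exact: ltW.
have dd : del ^+ 2 < C - 1.
  have : 0 <= del ^+ 2 * C by rewrite mulr_ge0 ?sqr_ge0 //; lra.
  lra.
have h1 : (b + 2 * a * C) * (del - b) >= 0 by apply: mulr_ge0; lra.
(* the constraint is a convex quadratic in b, negative at both end points *)
have e1 : (b + 2 * a * C) * b <= (b + 2 * a * C) * del by lra.
have e2 : 2 * a * C * del <= 2 * C * del ^+ 2.
  have : 0 <= C * del * (del - a) by rewrite !mulr_ge0 //; lra.
  by rewrite expr2; lra.
have e3 : b * del <= del ^+ 2.
  have : 0 <= del * (del - b) by rewrite mulr_ge0 //; lra.
  by rewrite expr2; lra.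
have e4 : 0 < (C - 1) * (C - 1) by rewrite mulr_gt0 //; lra.
move: q e1 e2 e3 e4 dfg; rewrite sqrrN; lra.
Qed.

Lemma exists_thin : exists2 del : R, 0 < del &
  forall f g, ⟨e f, e g⟩ < -1 -> del ^+ 2 * (1 - ⟨e f, e g⟩) < - ⟨e f, e g⟩ - 1.
Proof.
have /for_small_ex [s s0 h] : for_small (fun s : R => forall p : F * F,
  ⟨e p.1, e p.2⟩ < -1 -> s ^+ 2 * (1 - ⟨e p.1, e p.2⟩) < - ⟨e p.1, e p.2⟩ - 1).
  apply: for_small_forall => p; have [pp|pp] := ltP ⟨e p.1, e p.2⟩ (-1); last by exists 1.
  have h : ⟨e p.1, e p.2⟩ + 1 < 0 by lra.
  have [a a0 ha] := for_small_quad 0 (1 - ⟨e p.1, e p.2⟩) h.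
  by exists a => // t /ha; lra.
by exists s => // f g; apply: (h (f, g)).
Qed.

(** By [reflect_thin], each reflection in the mirror of a face beyond which [y]
    lies decreases the number of these faces. *)
Lemma cover_thin y (del : R) : hyperboloid y -> 0 < del ->
  (forall f g, ⟨e f, e g⟩ < -1 -> del ^+ 2 * (1 - ⟨e f, e g⟩) < - ⟨e f, e g⟩ - 1) ->
  (forall f, ⟨y, e f⟩ <= del) -> exists w, polyhedron e (word_mx e w *m y).
Proof.
move=> hy d0 dd; have [n] := ubnP #|[set f | 0 < ⟨y, e f⟩]|.
elim: n y hy => // n IH y hy; rewrite ltnS => card_n yd.
have [[f yf]|all_le] := pselect (exists f, 0 < ⟨y, e f⟩); last first.
  exists [::]; rewrite mul1mx; split=> // f; rewrite leNgt; apply/negP => yf.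
  by apply: all_le; exists f.
have new g : g != f ->
  (⟨reflection (e f) *m y, e g⟩ <= ⟨y, e g⟩) || (⟨reflection (e f) *m y, e g⟩ < 0).
  rewrite eq_sym => /ras.2 [fg|fg]; first by rewrite reflection_orth // lexx.
  apply/orP; right; rewrite reflectionE !lorentzL.
  by apply: reflect_thin (dd _ _ fg) _ _ _ => //; rewrite yf yd.
have rf : ⟨reflection (e f) *m y, e f⟩ < 0 by rewrite reflection_same // oppr_lt0.
have hy' : hyperboloid (reflection (e f) *m y).
  by have := word_mx_hyperboloid ras [:: f] hy; rewrite /= mulr1.
case: (IH _ hy') => [|g|w Pw]; last by exists (rcons w f); rewrite -cats1 word_mx_cat /= mulr1 -mulmxA.
- apply: leq_trans card_n; apply: proper_card; apply/properP; split.
    apply/fintype.subsetP => g; rewrite !inE => yg.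
    have [gf|/new/orP[h|h]] := eqVneq g f.
    + by move: yg; rewrite gf ltNge ltW.
    + exact: lt_le_trans h.
    + by move: yg; rewrite ltNge ltW.
  by exists f; rewrite !inE // -leNgt ltW.
- have [->|/new/orP[h|h]] := eqVneq g f; first exact: le_trans (ltW rf) (ltW d0).
    exact: le_trans h (yd g).
  exact: le_trans (ltW h) (ltW d0).
Qed.

(** Reflecting in a mirror that separates [y] from [x0] brings [y] closer to
    [x0]; points not far beyond any mirror are treated by [cover_thin]. *)
Lemma polyhedron_cover y : hyperboloid y -> exists w, polyhedron e (word_mx e w *m y).
Proof.
move=> hy; have [del d0 dd] := exists_thin.
have [k k0 hk] : exists2 k : R, 0 < k & forall f, k <= - ⟨x0, e f⟩.
  have /for_small_ex [k k0 hk] : for_small (fun k : R => forall f, ⟨x0, e f⟩ + k * 1 < 0).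
    by apply: for_small_forall => f; apply: for_small_lin.
  by exists k => // f; have := hk f; lra.
have kd : 0 < 2 * del * k by rewrite !mulr_gt0.
have [N] : exists N : nat, - ⟨x0, y⟩ <= N%:R * (2 * del * k).
  exists (Num.bound (- ⟨x0, y⟩ / (2 * del * k))).
  rewrite -ler_pdivrMr //; apply/ltW/archi_boundP.
  by rewrite divr_ge0 ?(ltW kd) //; have := hyperboloid_ge1 hx0 hy; lra.
elim: N y hy => [|N IH] y hy hN.
  by have := hyperboloid_ge1 hx0 hy; rewrite mul0r in hN; lra.
have [[f yf]|all_le] := pselect (exists f, del < ⟨y, e f⟩); last first.
  apply: (cover_thin hy d0 dd) => f; rewrite leNgt; apply/negP => yf.
  by apply: all_le; exists f.
have hy' : hyperboloid (reflection (e f) *m y).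
  by have := word_mx_hyperboloid ras [:: f] hy; rewrite /= mulr1.
have [|w Pw] := IH _ hy'; last first.
  by exists (rcons w f); rewrite -cats1 word_mx_cat /= mulr1 -mulmxA.
rewrite reflectionE !lorentzL; move: hN; rewrite -natr1 mulrDl mul1r.
suff : del * k <= ⟨y, e f⟩ * - ⟨x0, e f⟩ by lra.
by apply: ler_pM; [exact: ltW|exact: ltW|exact: ltW|exact: hk].
Qed.

(** ** Torsion *)

(** An element of finite order fixes a point, which can be moved into the
    polyhedron. The stabilizer of this point is generated by reflections in
    pairwise orthogonal mirrors, whose colors are told apart by [lam]. *)
Lemma word_torsion_free (V : zmodType) (col : F -> V) w m :
  (forall c : V, c + c = 0) ->
  (forall (I : F -> Prop) f, I f -> (forall s t, I s -> I t -> s != t -> ⟨e s, e t⟩ = 0) ->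
    exists lam : V -> bool, [/\ {morph lam : a b / a + b >-> a (+) b}, lam (col f) &
      forall h, I h -> h != f -> lam (col h) = false]) ->
  word_color col w = 0 -> (0 < m)%N -> word_mx e w ^+ m = 1 -> word_mx e w = 1.
Proof.
move=> col2 sep col0 m0 wm; (* the sum of the orbit of an interior point is fixed *)
pose z := \sum_(i < m) word_mx e w ^+ i *m x0.
have wmE i : exists v, word_mx e w ^+ i = word_mx e v.
  elim: i => [|i [v IH]]; first by exists [::].
  by exists (w ++ v); rewrite exprS IH word_mx_cat.
have fz : future z.
  rewrite /z; case: m m0 {wm z} => // m _; elim: m => [|m IH].
    by rewrite big_ord1 mul1mx; apply: hyperboloid_future.
  rewrite big_ord_recr /=; apply: futureD => //; have [v ->] := wmE m.+1.
  by apply: word_mx_future => //; apply: hyperboloid_future.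
have wz : word_mx e w *m z = z.
  rewrite /z; case: m m0 wm {z fz} => // m _ wm.
  rewrite [RHS]big_ord_recl big_ord_recr /= mulmxDr addrC; congr (_ + _).
    by rewrite mulmxA -[_ *m (_ ^+ _)]/(_ * _) -exprS wm expr0.
  rewrite mulmx_sumr; apply: eq_bigr => i _; rewrite mulmxA.
  by rewrite -[_ *m (_ ^+ _)]/(_ * _) -exprS.
have hz := normalize_hyperboloid fz.
have [u [_ Pu]] := polyhedron_cover hz; set x := word_mx e u *m _ in Pu.
have [v [cv vE vc]] := climbing_chamber col col2 (u ++ w ++ rev u).
have vx : word_mx e v *m x = x.
  rewrite vE !word_mx_cat /x /normalize -!scalemxAr.
  rewrite -[(_ * _ : 'M[R]_d.+1)]/(_ *m (_ *m _)) -!mulmxA (mulmxA (word_mx e (rev u))).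
  by rewrite (word_mx_rev ras u : _ *m _ = _) mul1mx wz.
have vI := climbing_stabilizer Pu cv vx.
have {vc} vc : word_color col v = 0.
  by rewrite vc !word_color_cat col0 add0r word_color_rev col2.
suff v1 : word_mx e v = 1.
  have : word_mx e u * word_mx e w * (word_mx e u)^-1 = 1.
    by rewrite word_mxV // -mulrA -!word_mx_cat -vE.
  move/(congr1 (fun g => (word_mx e u)^-1 * g * word_mx e u)).
  rewrite mulr1 mulVr ?word_mx_unit // -!mulrA mulVr ?word_mx_unit // mulr1.
  by rewrite mulrA mulVr ?word_mx_unit // mul1r.
case: v cv vx vI vc vE => // t v cv vx vI vc _.
have orthI s s' : s \in t :: v -> s' \in t :: v -> s != s' -> ⟨e s, e s'⟩ = 0.
  move=> /vI xs /vI xs' /ras.2 [//|ss'].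
  have := gram3_bound (word_mx_hyperboloid ras u hz) ss'; rewrite -/x xs xs'.
  have : 0 < (⟨e s, e s'⟩ - 1) * (⟨e s, e s'⟩ + 1) by rewrite nmulr_rgt0; lra.
  by rewrite !expr2; lra.
have [lam [lamD lamt lamI]] := sep (fun s => s \in t :: v) t (mem_head t v) orthI.
have lam0 : lam 0 = false by have := lamD 0 0; rewrite addr0; case: (lam 0).
(* e t is an eigenvector of each of these reflections, with sign given by lam *)
have act v' : {subset v' <= t :: v} ->
  word_mx e v' *m e t = if lam (word_color col v') then - e t else e t.
  elim: v' => [|s v' IH] sv'.
    by rewrite /word_color big_nil lam0 mul1mx.
  have {}IH : word_mx e v' *m e t = if lam (word_color col v') then - e t else e t.
    by apply: IH => r rv; apply: sv'; rewrite inE rv orbT.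
  have rs : reflection (e s) *m e t = if lam (col s) then - e t else e t.
    have [->|st] := eqVneq s t.
      by rewrite lamt reflectionE unit_e mulr1 scaler_nat mulr2n opprD addNKr.
    have sI : s \in t :: v by apply: sv'; rewrite mem_head.
    by rewrite lamI // reflectionE lorentzC orthI ?mem_head // mulr0 scale0r subr0.
  rewrite word_mx_cons IH word_color_cons lamD.
  by case: (lam (word_color col v')); rewrite ?mulmxN rs; case: (lam (col s)); rewrite //= opprK.
have := act (t :: v) (fun _ h => h); rewrite vc lam0 => vt.
have := word_mx_lorentz ras (t :: v) x0 (e t); rewrite vt.
rewrite word_mx_cons reflection_same //; case: cv => _ wt E.
by exfalso; have := x0e t; lra.
Qed.

End Chambers.

(** * Geodesics and translation lengths *)

Section HyperbolicFunctions.
Context {R : realType}.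
Implicit Types (s t u v : R).

Definition cosh t : R := (expR t + expR (- t)) / 2.
Definition sinh t : R := (expR t - expR (- t)) / 2.

Lemma cosh0 : cosh 0 = 1. Proof. by rewrite /cosh oppr0 expR0; lra. Qed.
Lemma sinh0 : sinh 0 = 0. Proof. by rewrite /sinh oppr0 expR0; lra. Qed.
Lemma coshN t : cosh (- t) = cosh t. Proof. by rewrite /cosh opprK addrC. Qed.
Lemma sinhN t : sinh (- t) = - sinh t. Proof. by rewrite /sinh opprK; lra. Qed.

Lemma coshD s t : cosh (s + t) = cosh s * cosh t + sinh s * sinh t.
Proof. by rewrite /cosh /sinh opprD !expRD; lra. Qed.

Lemma sinhD s t : sinh (s + t) = sinh s * cosh t + cosh s * sinh t.
Proof. by rewrite /cosh /sinh opprD !expRD; lra. Qed.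

Lemma cosh_sq t : cosh t ^+ 2 = 1 + sinh t ^+ 2.
Proof.
have := coshD t (- t); rewrite subrr cosh0 coshN sinhN !expr2; lra.
Qed.

Lemma sinh_gt0 t : 0 < t -> 0 < sinh t.
Proof. by move=> t0; rewrite divr_gt0 // subr_gt0 ltr_expR gtrN. Qed.

Lemma cosh_gt0 t : 0 < cosh t.
Proof. by rewrite divr_gt0 // addr_gt0 // expR_gt0. Qed.

Lemma cosh_ge1 t : 1 <= cosh t.
Proof.
have c0 := ltW (cosh_gt0 t); rewrite -ler_sqr ?nnegrE // expr1n cosh_sq lerDl.
exact: sqr_ge0.
Qed.

Lemma cosh_gt1 t : 0 < t -> 1 < cosh t.
Proof.
move=> t0; have c0 := ltW (cosh_gt0 t); rewrite -ltr_sqr ?nnegrE // expr1n cosh_sq ltrDl.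
by rewrite exprn_gt0 ?sinh_gt0.
Qed.

Lemma cosh_gt_half t : t / 2 < cosh t.
Proof.
rewrite ltr_pM2r ?invr_gt0 //; apply: lt_le_trans (_ : 1 + t <= _); first by lra.
by apply: le_trans (expR_ge1Dx t) _; rewrite lerDl expR_ge0.
Qed.

Lemma arcosh_cosh t : 0 <= t -> arcosh (cosh t) = t.
Proof.
move=> t0; have s0 : 0 <= sinh t.
  by move: t0; rewrite le_eqVlt => /predU1P[<-|/sinh_gt0/ltW//]; rewrite sinh0.
rewrite /arcosh cosh_sq addrAC subrr add0r sqrtr_sqr ger0_norm // -[RHS]expRK; congr ln.
by rewrite /cosh /sinh; lra.
Qed.

Lemma arcosh_ge0 u : 1 <= u -> 0 <= arcosh u.
Proof. by move=> u1; apply: ln_ge0; apply: le_trans u1 _; rewrite lerDl sqrtr_ge0. Qed.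

Lemma cosh_arcosh u : 1 <= u -> cosh (arcosh u) = u.
Proof.
move=> u1; set s := Num.sqrt (u ^+ 2 - 1).
have s0 : 0 <= s by rewrite sqrtr_ge0.
have us : 0 < u + s by lra.
have u2 : 0 <= u ^+ 2 - 1 by rewrite subr_ge0 exprn_ege1.
rewrite /cosh /arcosh -/s expRN lnK ?posrE //.
have ss : s ^+ 2 = u ^+ 2 - 1 by rewrite sqr_sqrtr.
have -> : (u + s)^-1 = u - s.
  apply: (mulIf (lt0r_neq0 us)); rewrite mulVf ?gt_eqF //.
  have -> : (u - s) * (u + s) = u ^+ 2 - s ^+ 2 by ring.
  by rewrite ss; ring.
by field.
Qed.

Lemma arcosh_le u v : 1 <= u -> u <= v -> arcosh u <= arcosh v.
Proof.
move=> u1 uv; rewrite /arcosh ler_ln ?posrE.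
- by apply: lerD => //; rewrite ler_wsqrtr // lerD2r ler_sqr ?nnegrE; lra.
- by rewrite ltr_wpDr ?sqrtr_ge0 //; lra.
- by rewrite ltr_wpDr ?sqrtr_ge0 //; lra.
Qed.

Lemma arcosh_gt0 u : 1 < u -> 0 < arcosh u.
Proof.
move=> u1; rewrite lt_def arcosh_ge0 ?(ltW u1) // andbT; apply/eqP => u0.
by have := cosh_arcosh (ltW u1); rewrite u0 cosh0; lra.
Qed.

End HyperbolicFunctions.

Section PlaneVectors.
Context {R : pzRingType} {V : lmodType R}.
Implicit Types (a b k : R) (p w : V).

Lemma comb2Z k a b p w : k *: (a *: p + b *: w) = (k * a) *: p + (k * b) *: w.
Proof. by rewrite scalerDr !scalerA. Qed.

Lemma comb2D a b a' b' p w :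
  (a *: p + b *: w) + (a' *: p + b' *: w) = (a + a') *: p + (b + b') *: w.
Proof. by rewrite addrACA !scalerDl. Qed.

Lemma comb2N a b p w : - (a *: p + b *: w) = (- a) *: p + (- b) *: w.
Proof. by rewrite opprD !scaleNr. Qed.

Lemma comb2B a b k p w : (a *: p + b *: - w) - k *: w = a *: p + (b + k) *: - w.
Proof. by rewrite -addrA scalerDl [k *: - w]scalerN. Qed.

Lemma comb2BB a b k a' b' p w : (a *: p + b *: - w) - k *: (a' *: p - b' *: w)
  = (a - k * a') *: p + (b - k * b') *: - w.
Proof. by rewrite -(scalerN b') comb2Z comb2N comb2D. Qed.

End PlaneVectors.

Section Geodesics.
Context {R : realType} {d : nat}.
Implicit Types (c : R -> 'cV[R]_d.+1) (p w x y : 'cV[R]_d.+1) (s t l : R).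

Lemma geodesic_lorentz c s t : geodesic_line c -> ⟨c s, c t⟩ = - cosh (s - t).
Proof.
move=> [hc dc]; have ge1 := hyperboloid_ge1 (hc s) (hc t).
have := dc s t; rewrite /hdist => /(congr1 cosh); rewrite cosh_arcosh //.
by case: (ger0P (s - t)) => _; rewrite ?coshN; lra.
Qed.

(** The products of the points of a geodesic line are known, and they show that
    the difference of both sides is a null vector orthogonal to [c 0]. *)
Lemma geodesic_param c : geodesic_line c -> exists w,
  [/\ ⟨c 0, w⟩ = 0, ⟨w, w⟩ = 1 & forall t, c t = cosh t *: c 0 + sinh t *: w].
Proof.
move=> gc; have G s t := geodesic_lorentz s t gc.
have s1 : sinh (1 : R) != 0 by rewrite gt_eqF ?sinh_gt0.
pose w := (sinh 1)^-1 *: (c 1 - cosh 1 *: c 0).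
have c0w : ⟨c 0, w⟩ = 0.
  by rewrite /w !lorentzL !G subrr sub0r coshN cosh0; ring.
have ww : ⟨w, w⟩ = 1.
  rewrite /w lorentzZl lorentzZr.
  have -> : ⟨c 1 - cosh 1 *: c 0, c 1 - cosh 1 *: c 0⟩ = sinh 1 ^+ 2.
    rewrite !lorentzL !G !subrr sub0r subr0 coshN cosh0.
    by have := cosh_sq (1 : R); rewrite !expr2; lra.
  by field.
have ctw t : ⟨c t, w⟩ = sinh t.
  rewrite /w !lorentzL !G subr0 coshD coshN sinhN.
  by field.
clearbody w; exists w; split=> // t.
apply/eqP; rewrite -subr_eq0; apply/eqP; apply: (@timelike_orth_eq0 _ _ (c 0)).
- by rewrite G subrr cosh0 ltrN10.
- by rewrite !lorentzL !G subrr cosh0 c0w sub0r coshN; ring.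
- rewrite !lorentzL !(lorentzC w) !G !subrr !sub0r !subr0 coshN cosh0 c0w ctw ww.
  by have := cosh_sq t; rewrite !expr2; lra.
Qed.

Lemma geodesic_of_param p w : hyperboloid p -> ⟨p, w⟩ = 0 -> ⟨w, w⟩ = 1 ->
  geodesic_line (fun t => cosh t *: p + sinh t *: w).
Proof.
move=> hp pw ww.
have G s t : ⟨cosh s *: p + sinh s *: w, cosh t *: p + sinh t *: w⟩ = - cosh (s - t).
  by rewrite !lorentzL hp.1 (lorentzC w p) pw ww coshD coshN sinhN; ring.
split=> [t|s t].
  split; first by rewrite G subrr cosh0.
  apply: (future_of_lt0 (hyperboloid_future hp) _ _).2.
    by rewrite G subrr cosh0 ltrN10.
  by rewrite !lorentzL hp.1 pw; have := cosh_gt0 t; lra.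
rewrite /hdist G opprK; case: (ger0P (s - t)) => st; first by rewrite arcosh_cosh.
by rewrite -coshN arcosh_cosh // oppr_ge0 ltW.
Qed.

(** Split [n] into a component in the plane of the axis, on which [g] acts as a
    boost by [l], and a component orthogonal to it, where the form is positive
    definite. The axis crosses the mirror of [n] transversally, so that the first
    component is spacelike. *)
Lemma translation_crossing (g : 'M[R]_d.+1) c l n : preserves_lorentz g ->
  geodesic_line c -> 0 < l -> (forall t, g *m c t = c (t + l)) ->
  ⟨n, n⟩ = 1 ->
  (exists2 t, 0 < t & ⟨c 0, n⟩ <= 0 < ⟨c t, n⟩) ->
  [/\ g *m n <> n, g *m n <> - n & `|⟨g *m n, n⟩| <= cosh l].
Proof.
move=> pg gc l0 gl nn [t t0 /andP[c0n ctn]].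
have [w [c0w ww cE]] := geodesic_param gc.
have s1 : sinh (1 : R) != 0 by rewrite gt_eqF ?sinh_gt0.
have gc0 : g *m c 0 = cosh l *: c 0 + sinh l *: w by rewrite gl add0r cE.
have gw : g *m w = sinh l *: c 0 + cosh l *: w.
  apply: (scalerI s1); have := gl 1; rewrite (cE 1) mulmxDr -!scalemxAr gc0.
  rewrite (cE (1 + l)) coshD sinhD => /(canRL (addKr _)) ->.
  rewrite !comb2Z comb2N comb2D.
  by congr (_ *: _ + _ *: _); ring.
set a := ⟨c 0, n⟩ in c0n *; set b := ⟨w, n⟩.
have ab : a ^+ 2 < b ^+ 2.
  have s0 := sinh_gt0 t0; have := ctn; rewrite cE !lorentzL -/a -/b => h.
  have cs : sinh t <= cosh t.
    by rewrite -ler_sqr ?nnegrE ?(ltW s0) ?(ltW (cosh_gt0 t)) // cosh_sq lerDr ler01.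
  have h1 : 0 <= - a * (cosh t - sinh t) by apply: mulr_ge0; lra.
  have : 0 < sinh t * (b + a) by lra.
  rewrite pmulr_rgt0 // => ba.
  by rewrite -sqrrN ltr_sqr ?nnegrE; lra.
have c0c0 : ⟨c 0, c 0⟩ = -1 by case: (gc.1 0).
have A0 : 0 < b ^+ 2 - a ^+ 2 by rewrite subr_gt0.
(* the component of n along the plane of the axis has norm b^2 - a^2, and its
   product with its image is cosh l times this *)
have not_fixed (s : R) : s ^+ 2 = 1 -> g *m n <> s *: n.
  move=> s2 gn; have := pg (c 0) n; have := pg w n.
  rewrite gn gc0 gw !lorentzL -/a -/b => e2 e1.
  have : cosh l * (b ^+ 2 - a ^+ 2) = s * (b ^+ 2 - a ^+ 2).
    have -> : cosh l * (b ^+ 2 - a ^+ 2) = s ^+ 2 * (cosh l * (b ^+ 2 - a ^+ 2)).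
      by rewrite s2 mul1r.
    have -> : s ^+ 2 * (cosh l * (b ^+ 2 - a ^+ 2)) =
      s * (b * (s * (sinh l * a + cosh l * b)) - a * (s * (cosh l * a + sinh l * b)))
      by ring.
    by rewrite e1 e2; ring.
  move/(mulIf (lt0r_neq0 A0)) => cl; have := cosh_gt1 l0; rewrite cl => s1'.
  have : s * 1 < s * s by rewrite ltr_pM2l //; lra.
  by rewrite -expr2 s2; lra.
split.
- by move=> gn; apply: (not_fixed 1); rewrite ?expr1n ?scale1r.
- by move=> gn; apply: (not_fixed (-1)); rewrite ?sqrrN ?expr1n ?scaleN1r.
(* the component of n orthogonal to the axis *)
pose m := n + a *: c 0 - b *: w.
have nE : n = m - a *: c 0 + b *: w by rewrite /m addrAC subrK addrK.
have mc0 : ⟨m, c 0⟩ = 0.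
  by rewrite /m !lorentzL c0c0 (lorentzC w) c0w (lorentzC n) -/a; ring.
have mw : ⟨m, w⟩ = 0 by rewrite /m !lorentzL c0w ww (lorentzC n) -/b; ring.
have mm : ⟨m, m⟩ = 1 - (b ^+ 2 - a ^+ 2).
  rewrite /m !lorentzL c0c0 nn ww (lorentzC w (c 0)) c0w (lorentzC n (c 0)) (lorentzC n w).
  by rewrite -/a -/b; ring.
clearbody m.
have gcl : ⟨g *m c 0, g *m c 0⟩ < 0 by rewrite pg c0c0 ltrN10.
have gm0 : ⟨g *m c 0, g *m m⟩ = 0 by rewrite pg lorentzC.
have m0 : ⟨g *m c 0, m⟩ = 0 by rewrite gc0 !lorentzL !(lorentzC _ m) mc0 mw; ring.
have gmc0 : ⟨g *m m, c 0⟩ = 0 /\ ⟨g *m m, w⟩ = 0.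
  have h1 : cosh l * ⟨g *m m, c 0⟩ + sinh l * ⟨g *m m, w⟩ = 0.
    by rewrite -!lorentzZr -lorentzDr -gc0 pg.
  have h2 : sinh l * ⟨g *m m, c 0⟩ + cosh l * ⟨g *m m, w⟩ = 0.
    by rewrite -!lorentzZr -lorentzDr -gw pg.
  have cs := cosh_sq l; move: (⟨g *m m, c 0⟩) (⟨g *m m, w⟩) h1 h2 => u v h1 h2; split.
    have : (cosh l ^+ 2 - sinh l ^+ 2) * u = cosh l * (cosh l * u + sinh l * v)
      - sinh l * (sinh l * u + cosh l * v) by ring.
    by rewrite h1 h2 cs addrK; lra.
  have : (cosh l ^+ 2 - sinh l ^+ 2) * v = cosh l * (sinh l * u + cosh l * v)
      - sinh l * (cosh l * u + sinh l * v) by ring.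
  by rewrite h1 h2 cs addrK; lra.
have := orth_Cauchy gcl gm0 m0; rewrite pg mm => CS.
have mm0 : 0 <= 1 - (b ^+ 2 - a ^+ 2) by rewrite -mm; apply: timelike_orth gcl m0.
have {}CS : `|⟨g *m m, m⟩| <= 1 - (b ^+ 2 - a ^+ 2).
  by rewrite -(ger0_norm mm0) -ler_sqr ?nnegrE // !real_normK ?num_real // expr2.
have gnn : ⟨g *m n, n⟩ = ⟨g *m m, m⟩ + (b ^+ 2 - a ^+ 2) * cosh l.
  have [g1 g2] := gmc0.
  clearbody a b; rewrite nE mulmxDr mulmxBr -!scalemxAr gc0 gw !lorentzL.
  by rewrite g1 g2 c0c0 ww (lorentzC w (c 0)) (lorentzC w m) (lorentzC (c 0) m) c0w mc0 mw; ring.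
rewrite gnn; apply: le_trans (ler_normD _ _) _.
rewrite (ger0_norm (_ : 0 <= _ * cosh l)); last by rewrite mulr_ge0 ?(ltW A0) ?(ltW (cosh_gt0 l)).
have : 0 <= (1 - (b ^+ 2 - a ^+ 2)) * (cosh l - 1).
  by rewrite mulr_ge0 // subr_ge0 cosh_ge1.
lra.
Qed.

End Geodesics.

Section TranslationLengths.
Context {R : realType} {d : nat} {F : finType}.
Variable e : F -> 'cV[R]_d.+1.
Hypothesis ras : right_angled_system e.

(** After conjugation, the axis starts in the polyhedron, which is bounded, and
    leaves it through some face [f]; then [climbing_root_far] applies to the
    image of [e f]. *)
Lemma translation_length_bound (m l : R) x0 w :
  hyperboloid x0 -> (forall f, ⟨x0, e f⟩ < 0) ->
  (exists B, forall x y, polyhedron e x -> polyhedron e y -> - ⟨x, y⟩ <= B) ->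
  1 <= m -> (forall f h, ⟨e f, e h⟩ < -1 -> ⟨e f, e h⟩ <= - m) ->
  loxodromic (word_mx e w) l -> 2 * m ^+ 2 - 1 <= cosh l.
Proof.
move=> hx0 x0e [B hB] m1 mle [l0 [c gc gl]].
have [u Pu] := polyhedron_cover ras hx0 x0e (gc.1 0).
pose c' t := word_mx e u *m c t.
have gc' : geodesic_line c'.
  split=> [t|s t]; first by apply: word_mx_hyperboloid => //; apply: gc.1.
  by rewrite /hdist word_mx_lorentz //; apply: gc.2.
pose v := u ++ w ++ rev u.
have gl' t : word_mx e v *m c' t = c' (t + l).
  rewrite /v !word_mx_cat -[(_ * _ : 'M[R]_d.+1)]/(_ *m (_ *m _)) -!mulmxA.
  by rewrite (mulmxA (word_mx e (rev u))) (word_mx_rev ras u : _ *m _ = _) mul1mx gl.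
have [t t0 [f ctf]] : exists2 t, 0 < t & exists f, 0 < ⟨c' t, e f⟩.
  pose t := 2 * `|B| + 1; have t0 : 0 < t by rewrite /t; have := normr_ge0 B; lra.
  exists t => //; apply: contrapT => no_exit.
  have Pt : polyhedron e (c' t).
    split=> [|f]; first exact: gc'.1.
    by rewrite leNgt; apply/negP => h; apply: no_exit; exists f.
  have := hB _ _ Pu Pt; rewrite -/(c' 0) geodesic_lorentz // sub0r coshN opprK.
  by have := cosh_gt_half t; have := ler_norm B; rewrite /t; lra.
have [|n1 n2 nle] := translation_crossing (word_mx_lorentz ras v) gc' l0 gl' (ras.1 f).
  by exists t => //; rewrite ctf andbT; case: Pu.
have [y cy yE] := root_climbing ras v f.
apply: le_trans nle.
case: (climbing_root_far ras m1 (mle f) cy) => [yf|].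
  by case: yE => E; [case: n1|case: n2]; rewrite E yf.
by case: yE => ->; rewrite ?lorentzNl ?normrN.
Qed.

(** ** The common perpendicular of two faces *)

Section CommonPerpendicular.
Variables (f g : F) (x0 : 'cV[R]_d.+1).
Hypotheses (hx0 : hyperboloid x0) (x0e : forall h, ⟨x0, e h⟩ < 0).
Hypothesis fg : ⟨e f, e g⟩ < -1.

Let C := - ⟨e f, e g⟩.
Let D := arcosh C.
Let C1 : 1 < C. Proof. by rewrite ltrNr. Qed.
Let C0 : 0 < C. Proof. exact: lt_trans C1. Qed.
Let D0 : 0 < D. Proof. exact: arcosh_gt0. Qed.
Let s0 : 0 < sinh D. Proof. exact: sinh_gt0. Qed.
Let coshD' : cosh D = C. Proof. by rewrite cosh_arcosh // ltW. Qed.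
Let CS : C ^+ 2 = 1 + sinh D ^+ 2. Proof. by rewrite -coshD' cosh_sq. Qed.
Let efg : ⟨e f, e g⟩ = - C. Proof. by rewrite /C opprK. Qed.
Let efE h : ⟨e h, e h⟩ = 1. Proof. exact: ras.1. Qed.

(** In the plane of the two normals, the vectors orthogonal to [e f] are the
    multiples of [e g + C *: e f]. *)
Lemma perpendicular_foot : exists p, [/\ hyperboloid p, ⟨p, e f⟩ = 0,
  ⟨p, e g⟩ = - sinh D & e g = sinh D *: p - C *: e f].
Proof.
pose p := (sinh D)^-1 *: (e g + C *: e f).
have pf : ⟨p, e f⟩ = 0 by rewrite /p !lorentzL efE (lorentzC (e g)) efg; ring.
have pg : ⟨p, e g⟩ = - sinh D.
  rewrite /p !lorentzL efE efg.
  have -> : (sinh D)^-1 * (1 + C * - C) = (sinh D)^-1 * (1 - C ^+ 2) by ring.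
  by rewrite CS; field; rewrite gt_eqF.
have pp : ⟨p, p⟩ = -1.
  rewrite {2}/p lorentzZr lorentzDr lorentzZr pf pg.
  by field; rewrite gt_eqF.
exists p; split=> //; last by rewrite /p scalerA mulfV ?gt_eqF // scale1r addrK.
split=> //; apply: (future_of_lt0 (hyperboloid_future hx0) _ _).2; first by rewrite pp ltrN10.
rewrite /p !lorentzL pmulr_rlt0 ?invr_gt0 //.
have : C * ⟨x0, e f⟩ < 0 by rewrite pmulr_rlt0.
by have := x0e g; lra.
Qed.

Section Axis.
Variable p : 'cV[R]_d.+1.
Hypotheses (hp : hyperboloid p) (pf : ⟨p, e f⟩ = 0) (pg : ⟨p, e g⟩ = - sinh D).
Hypothesis eg : e g = sinh D *: p - C *: e f.

Let axis t := cosh t *: p + sinh t *: - e f.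

Let axis_geodesic : geodesic_line axis.
Proof.
apply: geodesic_of_param => //; first by rewrite lorentzNr pf oppr0.
by rewrite !lorentzL efE opprK.
Qed.

Let axis_translation t : (reflection (e g) * reflection (e f)) *m axis t = axis (t + 2 * D).
Proof.
have axis_f s : reflection (e f) *m axis s = axis (- s).
  rewrite reflectionE /axis comb2B coshN sinhN !lorentzL pf efE.
  by congr (_ + _ *: _); ring.
have axis_g s : ⟨axis s, e g⟩ = sinh (s - D).
  rewrite /axis !lorentzL pg efg sinhD coshN sinhN coshD'; ring.
rewrite -mulmxA axis_f reflectionE axis_g eg /axis.
rewrite comb2BB.
have CC : C * C = 1 + sinh D * sinh D by have := CS; rewrite !expr2.
have -> : t + 2 * D = t + (D + D) by ring.
congr (_ *: _ + _ *: _); rewrite !(coshD, sinhD, coshN, sinhN) coshD'.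
  by have := congr1 ( *%R (cosh t)) CC; move: (cosh t) (sinh t) (sinh D) => *; lra.
by have := congr1 ( *%R (sinh t)) CC; move: (cosh t) (sinh t) (sinh D) => *; lra.
Qed.

Lemma perpendicular_loxodromic_at : loxodromic (reflection (e g) * reflection (e f)) (2 * D).
Proof. by split; [rewrite mulr_gt0|exists axis]. Qed.

Let le0 h : h != f -> h != g -> ⟨e f, e h⟩ <= 0 /\ ⟨e g, e h⟩ <= 0.
Proof.
have aux a b : a != b -> ⟨e a, e b⟩ <= 0 by case/ras.2; lra.
by move=> hf hg; split; apply: aux; rewrite eq_sym.
Qed.

Let foot_lorentz h : sinh D * ⟨p, e h⟩ = ⟨e g, e h⟩ + C * ⟨e f, e h⟩.
Proof. by rewrite {1}eg !lorentzL; ring. Qed.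

(** The products of the feet with the other normals are nonnegative
    combinations of products of normals, which are at most [0]. *)
Let face_foot : face e f (axis 0) /\ face e g (axis D).
Proof.
have a0 h : sinh D * ⟨axis 0, e h⟩ = ⟨e g, e h⟩ + C * ⟨e f, e h⟩.
  by rewrite /axis cosh0 sinh0 !lorentzL -foot_lorentz; ring.
have aD h : sinh D * ⟨axis D, e h⟩ = ⟨e f, e h⟩ + C * ⟨e g, e h⟩.
  rewrite /axis coshD' !lorentzL.
  have -> : sinh D * (C * ⟨p, e h⟩ + sinh D * - ⟨e f, e h⟩) =
    C * (sinh D * ⟨p, e h⟩) - sinh D ^+ 2 * ⟨e f, e h⟩ by ring.
  rewrite foot_lorentz (_ : sinh D ^+ 2 = C ^+ 2 - 1); last by rewrite CS addrC addKr.
  by ring.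
split; split.
- split=> [|h]; first exact: axis_geodesic.1.
  rewrite -(pmulr_rle0 _ s0) a0.
  have [->|hf] := eqVneq h f; first by rewrite efE (lorentzC (e g)) efg; lra.
  have [->|hg] := eqVneq h g.
    by rewrite efE efg; have : 0 < (C - 1) * (C + 1) by [rewrite mulr_gt0; have := C1; lra]; lra.
  have [le1 le2] := le0 hf hg.
  have : C * ⟨e f, e h⟩ <= 0 by rewrite pmulr_rle0.
  by lra.
- by apply: (mulfI (lt0r_neq0 s0)); rewrite a0 efE (lorentzC (e g)) efg; ring.
- split=> [|h]; first exact: axis_geodesic.1.
  rewrite -(pmulr_rle0 _ s0) aD.
  have [->|hg] := eqVneq h g; first by rewrite efE efg; lra.
  have [->|hf] := eqVneq h f.
    rewrite efE (lorentzC (e g)) efg.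
    by have : 0 < (C - 1) * (C + 1) by [rewrite mulr_gt0; have := C1; lra]; lra.
  have [le1 le2] := le0 hf hg.
  have : C * ⟨e g, e h⟩ <= 0 by rewrite pmulr_rle0.
  by lra.
- by apply: (mulfI (lt0r_neq0 s0)); rewrite aD efE efg; ring.
Qed.

Lemma perpendicular_feet : exists x y, [/\ face e f x, face e g y & hdist x y = D].
Proof.
have [f0 gD] := face_foot; exists (axis 0), (axis D); split=> //.
by rewrite axis_geodesic.2 sub0r normrN gtr0_norm.
Qed.

End Axis.

Lemma perpendicular_loxodromic : loxodromic (reflection (e g) * reflection (e f)) (2 * D).
Proof. by have [p []] := perpendicular_foot; apply: perpendicular_loxodromic_at. Qed.

(** Split [x] and [y] along the plane of the two normals and its orthogonal
    complement, and apply the Cauchy-Schwarz inequality in the latter. *)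
Let face_far x y : face e f x -> face e g y -> C <= - ⟨x, y⟩.
Proof.
move=> [[hx Px] xf] [[hy Py] yg]; pose a := ⟨y, e f⟩; pose b := ⟨x, e g⟩.
have S2 : 0 < sinh D ^+ 2 by rewrite exprn_gt0.
have CE : C * C = 1 + sinh D ^+ 2 by rewrite -expr2 CS.
set S := sinh D ^+ 2 in S2 CE *.
(* the components orthogonal to both normals *)
pose x' := x + (b / S) *: (e g + C *: e f).
pose y' := y + (a / S) *: (e f + C *: e g).
have x'f : ⟨x', e f⟩ = 0.
  by rewrite /x' !lorentzL xf efE (lorentzC (e g)) efg; ring.
have x'g : ⟨x', e g⟩ = 0.
  rewrite /x' !lorentzL efE efg -/b.
  have -> : b + b / S * (1 + C * - C) = b + b / S * (1 - C * C) by ring.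
  by rewrite CE; field; rewrite gt_eqF.
have y'g : ⟨y', e g⟩ = 0.
  by rewrite /y' !lorentzL yg efE efg; ring.
have y'f : ⟨y', e f⟩ = 0.
  rewrite /y' !lorentzL efE (lorentzC (e g)) efg -/a.
  have -> : a + a / S * (1 + C * - C) = a + a / S * (1 - C * C) by ring.
  by rewrite CE; field; rewrite gt_eqF.
have x'x' : ⟨x', x'⟩ = b ^+ 2 / S - 1.
  rewrite {2}/x' !lorentzDr !lorentzZr lorentzDr lorentzZr x'f x'g.
  by rewrite /x' !lorentzL hx.1 !(lorentzC _ x) xf -/b; ring.
have y'y' : ⟨y', y'⟩ = a ^+ 2 / S - 1.
  rewrite {2}/y' !lorentzDr !lorentzZr lorentzDr lorentzZr y'f y'g.
  by rewrite /y' !lorentzL hy.1 !(lorentzC _ y) yg -/a; ring.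
have x'y' : ⟨x', y'⟩ = ⟨x, y⟩ + a * b / S * C.
  rewrite {1}/y' !lorentzDr !lorentzZr lorentzDr lorentzZr x'f x'g.
  by rewrite /x' !lorentzL !(lorentzC _ y) yg -/a; ring.
clearbody x' y'; pose z := e f + e g.
have zz : ⟨z, z⟩ < 0 by rewrite /z !lorentzL !efE (lorentzC (e g)) efg; have := C1; lra.
have zx : ⟨z, x'⟩ = 0 by rewrite /z !lorentzL !(lorentzC _ x') x'f x'g addr0.
have zy : ⟨z, y'⟩ = 0 by rewrite /z !lorentzL !(lorentzC _ y') y'f y'g addr0.
have := orth_Cauchy zz zx zy; have := timelike_orth zz zx; have := timelike_orth zz zy.
rewrite x'y' x'x' y'y'.
pose K := a * b / S.
have K0 : 0 <= K by rewrite /K divr_ge0 ?(ltW S2) // mulr_le0 ?Px ?Py.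
have K2 : (b ^+ 2 / S) * (a ^+ 2 / S) = K ^+ 2 by rewrite /K; field; rewrite gt_eqF.
have KD : 2 * K <= b ^+ 2 / S + a ^+ 2 / S.
  rewrite -subr_ge0 (_ : _ - _ = (a - b) ^+ 2 / S); last by rewrite /K; field; rewrite gt_eqF.
  by rewrite divr_ge0 ?sqr_ge0 // ltW.
rewrite -/K; move: (b ^+ 2 / S) (a ^+ 2 / S) K2 KD => L M K2 KD M1 L1 h.
have K1 : 1 <= K.
  rewrite -ler_sqr ?nnegrE // -K2 expr1n; have : 0 <= (L - 1) * (M - 1) by rewrite mulr_ge0.
  lra.
have {}h : (⟨x, y⟩ + K * C) ^+ 2 <= (K - 1) ^+ 2.
  apply: le_trans h _; rewrite -subr_ge0.
  have -> : (K - 1) ^+ 2 - (L - 1) * (M - 1) = L + M - 2 * K + (K ^+ 2 - L * M) by ring.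
  by rewrite -K2 subrr addr0 subr_ge0.
have : ⟨x, y⟩ + K * C <= K - 1.
  rewrite leNgt; apply/negP => h'; move: h; rewrite leNgt; case/negP.
  by rewrite ltr_sqr ?nnegrE; lra.
have : 0 <= (K - 1) * (C - 1) by rewrite mulr_ge0 ?subr_ge0 // ltW.
lra.
Qed.

Lemma face_distance_perpendicular : face_distance e f g = D.
Proof.
have [p [hp pf pg eg]] := perpendicular_foot.
have [a [b [fa gb ab]]] := perpendicular_feet hp pf eg.
have lb : lbound [set hdist x y | x in face e f & y in face e g]%classic D.
  move=> _ [x fx [y gy <-]]; apply: arcosh_le; first exact: ltW.
  exact: face_far.
have inD : [set hdist x y | x in face e f & y in face e g]%classic D.
  by exists a => //; exists b.
apply/le_anti/andP; split; first by apply: ge_inf => //; exists D.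
by apply: lb_le_inf => //; exists D.
Qed.

End CommonPerpendicular.
End TranslationLengths.

(** * The Gram matrix of a Loebell polyhedron *)

Section FourDimensions.
Context {R : realType}.

Lemma dependent5 (v : 'I_5 -> 'cV[R]_4) :
  exists2 a : 'I_5 -> R, (exists i, a i != 0) & \sum_i a i *: v i = 0.
Proof.
pose M := \matrix_(i < 5, j < 4) v i j ord0.
have /rowV0Pn[a aM a0] : kermx M != 0.
  by rewrite kermx_eq0 /row_free neq_ltn (leq_ltn_trans (rank_leq_col M)).
exists (fun i => a 0 i); first by move/rV0Pn: a0.
apply/colP => j; move/sub_kermxP/rowP/(_ j): aM; rewrite summxE !mxE => aM.
by rewrite -[RHS]aM; apply: eq_bigr => i _; rewrite !mxE.
Qed.

(** The orthogonal complement of three orthonormal vectors is a line, on which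
    the Gram determinant of two vectors vanishes. *)
Lemma orthonormal3_line (x y z u v : 'cV[R]_4) :
  ⟨x, x⟩ = 1 -> ⟨y, y⟩ = 1 -> ⟨z, z⟩ = 1 -> ⟨x, y⟩ = 0 -> ⟨y, z⟩ = 0 -> ⟨x, z⟩ = 0 ->
  ⟨u, x⟩ = 0 -> ⟨u, y⟩ = 0 -> ⟨u, z⟩ = 0 -> ⟨v, x⟩ = 0 -> ⟨v, y⟩ = 0 -> ⟨v, z⟩ = 0 ->
  ⟨u, u⟩ * ⟨v, v⟩ = ⟨u, v⟩ ^+ 2.
Proof.
move=> xx yy zz xy yz xz ux uy uz vx vy vz.
have [a [i ai]] := dependent5 (fun i => nth 0 [:: u; v; x; y; z] i).
rewrite !big_ord_recl big_ord0 /= addr0.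
set a0 := a _; set a1 := a _; set a2 := a _; set a3 := a _; set a4 := a _ => E.
have pair t : a0 * ⟨u, t⟩ + (a1 * ⟨v, t⟩ + (a2 * ⟨x, t⟩ + (a3 * ⟨y, t⟩ + a4 * ⟨z, t⟩))) = 0.
  by rewrite -!lorentzZl -!lorentzDl E lorentz0l.
have a20 : a2 = 0.
  by have := pair x; rewrite ux vx xx (lorentzC y) (lorentzC z) xy xz; lra.
have a30 : a3 = 0 by have := pair y; rewrite uy vy xy yy (lorentzC z) yz; lra.
have a40 : a4 = 0 by have := pair z; rewrite uz vz xz yz zz; lra.
have pu := pair u; have pv := pair v; rewrite a20 a30 a40 !mul0r !addr0 in pu pv.
rewrite (lorentzC v u) in pu.
have [a00|a0n] := eqVneq a0 0; last first.
  by apply: (mulfI a0n); move: pu pv => /(congr1 ( *%R ⟨v, v⟩)) pu /(congr1 ( *%R ⟨u, v⟩)) pv;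
    rewrite expr2; lra.
have [a10|a1n] := eqVneq a1 0; last first.
  by apply: (mulfI a1n); move: pu pv => /(congr1 ( *%R ⟨u, v⟩)) pu /(congr1 ( *%R ⟨u, u⟩)) pv;
    rewrite expr2; lra.
move: ai; suff -> : a i = 0 by rewrite eqxx.
case: (unliftP ord0 i) => [j|] -> //; case: (unliftP ord0 j) => [{}j|] -> //.
case: (unliftP ord0 j) => [{}j|] -> //; case: (unliftP ord0 j) => [{}j|] -> //.
by rewrite (ord1 j).
Qed.

End FourDimensions.

Section Cosines.
Context {R : realType}.
Implicit Types (x psi c : R) (m N : nat).

Lemma cos_2piB x : cos (pi *+ 2 - x) = cos x.
Proof. by rewrite addrC cosD2pi cosN. Qed.

Lemma ler_cos x y : 0 <= x <= pi -> 0 <= y <= pi -> (cos x <= cos y) = (y <= x).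
Proof. by move=> hx hy; rewrite !leNgt ltr_cos ?in_itv. Qed.

Lemma cos_lt1 x : 0 < x < pi *+ 2 -> cos x < 1.
Proof.
have aux y : 0 < y <= pi -> cos y < 1.
  move=> /andP[y0 yp]; rewrite -cos0 ltr_cos // in_itv /= ?lexx ?pi_ge0 //.
  by rewrite (ltW y0).
move=> /andP[x0 x2]; have [xp|xp] := leP x pi; first by apply: aux; rewrite x0.
rewrite -cos_2piB; apply: aux; apply/andP; split; first by lra.
by rewrite mulr2n; lra.
Qed.

(** The Chebyshev recurrence determines [W] from its first two values. *)
Lemma cos_recurrence psi (W : nat -> R) : W 1 = cos psi * W 0 ->
  (forall m, W m.+2 = 2 * cos psi * W m.+1 - W m) -> forall m, W m = W 0 * cos (m%:R * psi).
Proof.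
move=> W1 WS m; suff : W m = W 0 * cos (m%:R * psi) /\ W m.+1 = W 0 * cos (m.+1%:R * psi).
  by case.
elim: m => [|m [IH0 IH1]]; first by rewrite mul0r cos0 mulr1 mul1r W1 mulrC.
split=> //; rewrite WS IH0 IH1.
have -> : m.+2%:R * psi = m.+1%:R * psi + psi by rewrite -[m.+2%:R]natr1; ring.
have -> : m%:R * psi = m.+1%:R * psi - psi by rewrite -[m.+1%:R]natr1; ring.
by rewrite (cosB _ psi) (cosD _ psi); ring.
Qed.

(** The last direction [m * psi] before a full turn is close to the first one,
    so it must be one of the last steps. *)
Lemma turn_once psi N : 0 < psi -> psi *+ 4 < pi -> (5 <= N)%N ->
  cos (N%:R * psi) = 1 ->
  (forall m, (3 <= m <= N - 3)%N -> cos (m%:R * psi) < cos psi) ->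
  N%:R * psi = pi *+ 2.
Proof.
move=> psi0 psi4 N5 cN cm.
have pi0 := pi_gt0 R.
have p4 : 4 * psi < pi by rewrite -mulr_natl in psi4.
(* the last step before a full turn comes closer than psi to the start *)
pose m := Num.truncn (pi *+ 2 / psi).
have m_ge0 : 0 <= pi *+ 2 / psi by rewrite divr_ge0 ?(ltW psi0) // mulrn_wge0 // ltW.
have := truncn_itv m_ge0; rewrite -/m ler_pdivlMr // ltr_pdivrMr // => /andP[mle mlt].
have {}mlt : pi *+ 2 < m%:R * psi + psi by move: mlt; rewrite -natr1; lra.
have m3 : (3 <= m)%N.
  rewrite leqNgt; apply/negP; rewrite ltnS => m2.
  have : m%:R * psi <= 2 * psi by rewrite ler_pM2r // ler_nat.
  by move: mlt; rewrite mulr2n; lra.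
have mN : (N - 3 < m)%N.
  rewrite ltnNge; apply/negP => mN; have := cm m; rewrite m3 mN => /(_ isT).
  rewrite -cos_2piB ltNge => /negP; apply.
  move: mle mlt; rewrite mulr2n => mle mlt.
  by rewrite ler_cos; [|apply/andP; split|apply/andP; split]; lra.
have Nm : N%:R * psi <= m%:R * psi + 2 * psi.
  by rewrite -mulrDl ler_pM2r // -natrD ler_nat; move: mN; clear; lia.
have N0 : 0 < N%:R * psi by rewrite mulr_gt0 // ltr0n; move: N5; clear; lia.
case: (ltgtP (N%:R * psi) (pi *+ 2)) => // hN.
  by have := @cos_lt1 (N%:R * psi); rewrite N0 hN cN ltxx => /(_ isT).
have /cos_lt1 : 0 < N%:R * psi - pi *+ 2 < pi *+ 2.
  by rewrite subr_gt0 hN /=; move: Nm mle; rewrite mulr2n; lra.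
by rewrite -cosD2pi subrK cN ltxx.
Qed.

Lemma cos_le_between psi N m a : 0 < psi -> N%:R * psi = pi *+ 2 ->
  (a <= m)%N -> (m + a <= N)%N -> cos (m%:R * psi) <= cos (a%:R * psi).
Proof.
move=> psi0 Npsi am maN.
have amR : a%:R * psi <= m%:R * psi by rewrite ler_pM2r // ler_nat.
have maR : m%:R * psi + a%:R * psi <= pi *+ 2.
  by rewrite -Npsi -mulrDl ler_pM2r // -natrD ler_nat.
have a0 : 0 <= a%:R * psi by rewrite mulr_ge0 // ltW.
have ap : a%:R * psi <= pi by move: maR; rewrite mulr2n; lra.
rewrite mulr2n in maR.
have [mp|mp] := leP (m%:R * psi) pi.
  by rewrite ler_cos //; apply/andP; split => //; lra.
by rewrite -cos_2piB mulr2n ler_cos; [|apply/andP; split|apply/andP; split]; lra.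
Qed.

End Cosines.

Section LateralFaces.
Context {R : realType}.
Variables (T B : 'cV[R]_4) (L : nat -> 'cV[R]_4) (N : nat).

(** Even indices are lower faces, odd indices are upper faces. *)
Definition near_base k := if odd k then T else B.
Definition far_base k := if odd k then B else T.

Hypotheses (TT : ⟨T, T⟩ = 1) (BB : ⟨B, B⟩ = 1) (TB : ⟨T, B⟩ < -1).
Hypotheses (LL : forall k, ⟨L k, L k⟩ = 1) (L1 : forall k, ⟨L k, L k.+1⟩ = 0)
  (L2 : forall k, ⟨L k, L k.+2⟩ = 0) (LN : forall k, L (k + N) = L k).
Hypotheses (L_near : forall k, ⟨L k, near_base k⟩ = 0)
  (L_far : forall k, ⟨L k, far_base k⟩ < -1).
Hypotheses (N_even : ~~ odd N) (N16 : (16 <= N)%N).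
Hypothesis L_disjoint : forall m, (3 <= m <= N - 3)%N -> ⟨L 0, L m⟩ < -1.

Let N8 : (8 <= N)%N. Proof. exact: leq_trans N16. Qed.

Let C := - ⟨T, B⟩.
Let p k := - ⟨L k, far_base k⟩.

Lemma base_lorentz k :
  [/\ ⟨near_base k, near_base k⟩ = 1, ⟨far_base k, far_base k⟩ = 1,
      ⟨near_base k, far_base k⟩ = - C & ⟨far_base k, near_base k⟩ = - C].
Proof. by rewrite /near_base /far_base /C opprK; case: (odd k); rewrite ?(lorentzC B). Qed.

Lemma near_baseS k : near_base k.+1 = far_base k.
Proof. by rewrite /near_base /far_base /=; case: odd. Qed.

Lemma far_baseS k : far_base k.+1 = near_base k.
Proof. by rewrite /near_base /far_base /=; case: odd. Qed.

Lemma L_far_p k : ⟨L k, far_base k⟩ = - p k. Proof. by rewrite opprK. Qed.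

Lemma p_gt1 k : 1 < p k. Proof. by rewrite ltrNr. Qed.

Lemma C_gt1 : 1 < C. Proof. by rewrite ltrNr. Qed.

(** Three consecutive lateral faces are pairwise orthogonal and cut out a line,
    on which the bases have a degenerate Gram matrix. *)
Lemma p_relation k : (p k ^+ 2 + p k.+2 ^+ 2 - 1) * (p k.+1 ^+ 2 - 1) = C ^+ 2.
Proof.
pose u := far_base k + p k *: L k + p k.+2 *: L k.+2.
pose v := near_base k + p k.+1 *: L k.+1.
have [nn ff nf fn] := base_lorentz k.
have h1 : ⟨far_base k, L k⟩ = - p k by rewrite lorentzC L_far_p.
have h2 : ⟨far_base k, L k.+1⟩ = 0 by rewrite lorentzC -near_baseS.
have h3 : ⟨far_base k, L k.+2⟩ = - p k.+2.
  by rewrite lorentzC -L_far_p far_baseS near_baseS.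
have h4 : ⟨near_base k, L k⟩ = 0 by rewrite lorentzC.
have h5 : ⟨near_base k, L k.+1⟩ = - p k.+1 by rewrite lorentzC -L_far_p far_baseS.
have h6 : ⟨near_base k, L k.+2⟩ = 0 by rewrite lorentzC -far_baseS -near_baseS.
have L1' j : ⟨L j.+1, L j⟩ = 0 by rewrite lorentzC.
have L2' j : ⟨L j.+2, L j⟩ = 0 by rewrite lorentzC.
have ux : ⟨u, L k⟩ = 0 by rewrite /u !lorentzL h1 LL L2'; ring.
have uy : ⟨u, L k.+1⟩ = 0 by rewrite /u !lorentzL h2 L1 L1'; ring.
have uz : ⟨u, L k.+2⟩ = 0 by rewrite /u !lorentzL h3 LL L2; ring.
have vx : ⟨v, L k⟩ = 0 by rewrite /v !lorentzL h4 L1'; ring.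
have vy : ⟨v, L k.+1⟩ = 0 by rewrite /v !lorentzL h5 LL; ring.
have vz : ⟨v, L k.+2⟩ = 0 by rewrite /v !lorentzL h6 L1; ring.
have := orthonormal3_line (LL k) (LL k.+1) (LL k.+2) (L1 k) (L1 k.+1) (L2 k) ux uy uz vx vy vz.
have uE w : ⟨u, w⟩ = ⟨far_base k, w⟩ + p k * ⟨L k, w⟩ + p k.+2 * ⟨L k.+2, w⟩.
  by rewrite /u !lorentzDl !lorentzZl.
have vE w : ⟨v, w⟩ = ⟨near_base k, w⟩ + p k.+1 * ⟨L k.+1, w⟩.
  by rewrite /v lorentzDl lorentzZl.
have -> : ⟨u, u⟩ = 1 - p k ^+ 2 - p k.+2 ^+ 2.
  rewrite uE !(lorentzC _ u) ux uz uE ff !(lorentzC _ (far_base k)) h1 h3; ring.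
have -> : ⟨v, v⟩ = 1 - p k.+1 ^+ 2.
  rewrite vE !(lorentzC _ v) vy vE nn !(lorentzC _ (near_base k)) h5; ring.
have -> : ⟨u, v⟩ = - C.
  rewrite lorentzC vE !(lorentzC _ u) uy uE fn !(lorentzC _ (near_base k)) h4 h6; ring.
by rewrite -(sqrrN C) => <-; ring.
Qed.

Lemma p_period k : p (k + N) = p k.
Proof. by rewrite /p LN /far_base oddD (negPf N_even) addbF. Qed.

Lemma p_mod k : p k = p (k %% N)%N.
Proof.
rewrite {1}(divn_eq k N); elim: (k %/ N)%N => [|q IH]; first by rewrite mul0n.
by rewrite mulSn -addnA addnC p_period.
Qed.

(** The maximum principle: at a maximum of [p] the two neighbours are at least
    the minimum, and conversely, and the two resulting inequalities force the
    maximum and the minimum to agree. *)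
Lemma p_const k : p k ^+ 2 = p 0 ^+ 2.
Proof.
have N0 : (0 < N)%N by move: N8; clear; lia.
pose i0 := Ordinal N0.
case: (@arg_maxP _ _ _ i0 predT (fun i : 'I_N => p i ^+ 2) isT) => iM _ iMmax.
case: (@arg_minP _ _ _ i0 predT (fun i : 'I_N => p i ^+ 2) isT) => im _ immin.
have leM j : p j ^+ 2 <= p iM ^+ 2.
  by rewrite (p_mod j); apply: (iMmax (Ordinal (ltn_pmod j N0))).
have gem j : p im ^+ 2 <= p j ^+ 2.
  by rewrite (p_mod j); apply: (immin (Ordinal (ltn_pmod j N0))).
have gt1 j : 1 < p j ^+ 2 by rewrite exprn_egt1 // p_gt1.
have mid (i : nat) : (p (i + N).-1 ^+ 2 + p (i + N).-1.+2 ^+ 2 - 1) * (p i ^+ 2 - 1) = C ^+ 2.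
  have := p_relation (i + N).-1; rewrite (_ : (i + N).-1.+1 = i + N)%N ?p_period //.
  by rewrite prednK // addn_gt0 N0 orbT.
have hM := mid iM; have hm := mid im.
have [a1 a2] := (gem (iM + N).-1, gem (iM + N).-1.+2).
have [b1 b2] := (leM (im + N).-1, leM (im + N).-1.+2).
have gM := gt1 iM; have gm := gt1 im.
have MleM : p iM ^+ 2 <= p im ^+ 2.
  move: (p iM ^+ 2) (p im ^+ 2) hM hm a1 a2 b1 b2 gM gm => M m hM hm a1 a2 b1 b2 gM gm.
  have h1 : (2 * m - 1) * (M - 1) <= C ^+ 2 by rewrite -hM ler_wpM2r //; lra.
  have h2 : C ^+ 2 <= (2 * M - 1) * (m - 1) by rewrite -hm ler_wpM2r //; lra.
  lra.
by apply/le_anti; rewrite (le_trans (leM k) (le_trans MleM (gem 0))) (le_trans (leM 0) (le_trans MleM (gem k))).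
Qed.

Let P := p 0 ^+ 2.

Lemma C_P : C ^+ 2 = (2 * P - 1) * (P - 1).
Proof. by have := p_relation 0; rewrite !p_const -/P => <-; ring. Qed.

Lemma P_gt : 3 / 2 < P.
Proof.
have P1 : 1 < P by rewrite exprn_egt1 // p_gt1.
have : 1 < C ^+ 2 by rewrite exprn_egt1 // C_gt1.
rewrite C_P => h; have : 0 < P * (2 * P - 3) by lra.
by rewrite pmulr_rgt0; lra.
Qed.

Lemma p_eq k : p k = p 0.
Proof.
have p_ge0 j : 0 <= p j by apply: ltW; apply: lt_trans (p_gt1 j); exact: ltr01.
by apply/eqP; rewrite -(@eqrXn2 _ 2) // p_const.
Qed.

(** The component of [L k] orthogonal to the normals of the bases, that is, its
    horizontal part when the common perpendicular of the bases is vertical. *)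
Let D k := L k - (p 0 / (C ^+ 2 - 1)) *: (far_base k + C *: near_base k).

Let c2P : C ^+ 2 - 1 = P * (2 * P - 3).
Proof. by rewrite C_P; ring. Qed.

Let P23 : 2 * P - 3 != 0.
Proof. by rewrite gt_eqF //; have := P_gt; lra. Qed.

Let P0 : P != 0.
Proof. by rewrite gt_eqF //; have := P_gt; lra. Qed.

Let P22 : 2 * P - 2 != 0.
Proof. by rewrite gt_eqF //; have := P_gt; lra. Qed.

Lemma D_base j k : ⟨D j, near_base k⟩ = 0 /\ ⟨D j, far_base k⟩ = 0.
Proof.
have [nn ff nf fn] := base_lorentz j.
have h1 : ⟨D j, near_base j⟩ = 0.
  by rewrite /D !lorentzL L_near nn fn; ring.
have h2 : ⟨D j, far_base j⟩ = 0.
  rewrite /D !lorentzL L_far_p ff nf p_eq.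
  have -> : 1 + C * - C = - (C ^+ 2 - 1) by ring.
  by field; rewrite c2P mulf_neq0.
have [E|E] := eqVneq (odd j) (odd k).
  by move: h1 h2; rewrite /near_base /far_base E.
have {}E : odd k = ~~ odd j by move: E; case: (odd j); case: (odd k).
by move: h1 h2; rewrite /near_base /far_base E; case: (odd j).
Qed.

Lemma D_lorentz j k : ⟨D j, D k⟩ =
  ⟨L j, L k⟩ + (if odd j == odd k then 1 else C) / (2 * P - 3).
Proof.
have [d1 d2] := D_base j k.
rewrite {2}/D !lorentzDr lorentzNr lorentzZr lorentzDr lorentzZr d1 d2 mulr0 addr0 mulr0 subr0.
rewrite {1}/D !lorentzDl lorentzNl lorentzZl lorentzDl lorentzZl.
have -> : ⟨far_base j, L k⟩ = if odd j == odd k then - p 0 else 0.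
  rewrite lorentzC; case: eqP => E; first by rewrite /far_base E -/(far_base k) L_far_p p_eq.
  have -> : far_base j = near_base k by move: E; rewrite /far_base /near_base; case: odd; case: odd.
  exact: L_near.
have -> : ⟨near_base j, L k⟩ = if odd j == odd k then 0 else - p 0.
  rewrite lorentzC; case: eqP => E; first by rewrite /near_base E -/(near_base k) L_near.
  have -> : near_base j = far_base k by move: E; rewrite /far_base /near_base; case: odd; case: odd.
  by rewrite L_far_p p_eq.
rewrite c2P; case: eqP => _; congr (_ + _); rewrite /P; field; rewrite -/P ?P0 ?P23 //;
  by rewrite -sqrf_eq0 P0.
Qed.

Let c := C / (2 * P - 2).

(** The difference is orthogonal to the timelike vector [T + B], and the values
    of [p] and [C] make its norm vanish. *)
Lemma D_recurrence k : D k.+2 = (2 * c) *: D k.+1 - D k.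
Proof.
have Db := D_base; have Dl := D_lorentz; clearbody D.
apply/eqP; rewrite -subr_eq0; apply/eqP.
apply: (@timelike_orth_eq0 _ _ (T + B)).
- rewrite !lorentzL TT BB (lorentzC B T); move: TB; lra.
- have TBD j : ⟨T + B, D j⟩ = 0.
    have [] := Db j 0; rewrite /near_base /far_base /= => h1 h2.
    by rewrite !lorentzDl !(lorentzC _ (D j)) h1 h2 addr0.
  by rewrite lorentzDr lorentzNr lorentzDr lorentzNr lorentzZr !TBD; ring.
have D0 j : ⟨D j, D j⟩ = 1 + (2 * P - 3)^-1 by rewrite Dl LL eqxx mul1r.
have D1 j : ⟨D j, D j.+1⟩ = C / (2 * P - 3).
  by rewrite Dl L1 add0r /=; case: (odd j).
have D2 j : ⟨D j, D j.+2⟩ = (2 * P - 3)^-1.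
  by rewrite Dl L2 add0r /= negbK eqxx mul1r.
have D1' j : ⟨D j.+1, D j⟩ = C / (2 * P - 3) by rewrite lorentzC.
have D2' j : ⟨D j.+2, D j⟩ = (2 * P - 3)^-1 by rewrite lorentzC.
rewrite !(lorentzDl, lorentzDr, lorentzNl, lorentzNr, lorentzZl, lorentzZr).
rewrite !D0 !D1' !D2' !D1 !D2 /c.
have -> : 1 + (2 * P - 3)^-1 = (2 * P - 2) / (2 * P - 3) by field.
transitivity ((2 * (2 * P - 1) - 4 * C ^+ 2 / (2 * P - 2)) / (2 * P - 3)).
  by field; rewrite P23.
rewrite C_P; field; rewrite P23 /=.
by rewrite gt_eqF //; have := P_gt; lra.
Qed.

Let c01 : 0 < c < 1.
Proof.
have P1 := P_gt; have c1 := C_gt1.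
have p22 : 0 < 2 * P - 2 by lra.
have C0 : 0 < C by apply: lt_trans c1; exact: ltr01.
rewrite /c divr_gt0 // ltr_pdivrMr // mul1r -ltr_sqr ?nnegrE ?(ltW p22) ?(ltW C0) //.
rewrite C_P expr2 -subr_gt0.
have -> : (2 * P - 2) * (2 * P - 2) - (2 * P - 1) * (P - 1) = (P - 1) * (2 * P - 3) by ring.
by rewrite mulr_gt0; lra.
Qed.

(** The angle between the horizontal parts of consecutive lateral normals. *)
Definition lateral_angle := acos c.
Let psi := lateral_angle.

Lemma cos_psi : cos psi = c.
Proof. by rewrite acosK // in_itv /=; have := c01; lra. Qed.

Lemma cos_2psi : cos (psi *+ 2) = (2 * P - 2)^-1.
Proof.
rewrite cos_mulr2n cos_psi /c expr_div_n C_P; field.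
by rewrite gt_eqF //; have := P_gt; lra.
Qed.

Lemma psi_gt0 : 0 < psi.
Proof. by apply: acos_gt0; have := c01; lra. Qed.

Lemma psi_lt : psi *+ 4 < pi.
Proof.
have c0 : 0 < cos psi by rewrite cos_psi; case/andP: c01.
have ppi : psi <= pi by apply: acos_lepi; have := c01; lra.
have pi0 := pi_gt0 R.
have p2 : psi < pi / 2.
  rewrite ltNge; apply/negP => h; move: c0; rewrite ltNge -(@cos_pihalf R) ler_cos ?h //.
  - by rewrite (ltW psi_gt0).
  - by apply/andP; split; lra.
have c20 : 0 < cos (psi *+ 2) by rewrite cos_2psi invr_gt0; have := P_gt; lra.
rewrite -[4%N]/(2 * 2)%N mulrnA.
suff : psi *+ 2 < pi / 2 by rewrite [X in X < pi]mulr2n; lra.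
rewrite ltNge; apply/negP => h; move: c20; rewrite ltNge -(@cos_pihalf R) ler_cos ?h //.
- by rewrite mulrn_wge0 ?(ltW psi_gt0) //= mulr2n; lra.
- by apply/andP; split; lra.
Qed.

(** The horizontal parts of the normals turn by the constant angle [psi], by
    [D_recurrence] and [cos_recurrence]. *)
Lemma lateral_lorentz k m : ⟨L k, L (k + m)⟩ =
  ((2 * P - 2) * cos (m%:R * psi) - (if odd m then C else 1)) / (2 * P - 3).
Proof.
have W m' : ⟨D k, D (k + m')⟩ = ⟨D k, D k⟩ * cos (m'%:R * psi).
  rewrite (cos_recurrence (psi := psi) (W := fun i => ⟨D k, D (k + i)⟩)) ?addn0 //.
    rewrite addn1 !D_lorentz L1 LL eqxx cos_psi /= /c.
    have -> : (odd k == ~~ odd k) = false by case: odd.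
    by field; rewrite P23.
  by move=> i; rewrite !addnS D_recurrence lorentzDr lorentzNr lorentzZr cos_psi; ring.
have := W m; rewrite !D_lorentz LL eqxx oddD.
have -> : (odd k == odd k (+) odd m) = ~~ odd m by case: odd; case: odd.
move/(canRL (addrK _)) => ->; case: (odd m) => /=; field.
  exact: P23.
exact: P23.
Qed.

(** Disjointness of the faces rules out that the normals turn several times. *)
Lemma psi_N : N%:R * psi = pi *+ 2.
Proof.
have P1 := P_gt; have ck := cos_psi; have c1 := C_gt1.
apply: turn_once psi_gt0 psi_lt _ _ _; first by move: N8; clear; lia.
  have := lateral_lorentz 0 N; rewrite LN LL (negPf N_even).
  move/(congr1 (fun x => x * (2 * P - 3))); rewrite divfK // => h.
  by apply: (mulfI P22); lra.
move=> m /L_disjoint; rewrite -[m in L m]add0n lateral_lorentz ltr_pdivrMr; last by lra.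
have pc : C = (2 * P - 2) * c by rewrite /c mulrC divfK.
have p22 : 0 < 2 * P - 2 by lra.
move=> h; rewrite cos_psi -(ltr_pM2l p22) -pc; move: h c1 P1.
by case: (odd m); lra.
Qed.

Let c2 := cos (psi *+ 2).

(** Sixteen lateral faces are enough for [4 * psi <= pi / 2], and the last
    inequality says that [cos (4 * psi)] is not negative. *)
Lemma c2_bounds : 0 < c2 < 1 /\ 1 <= 2 * c2 ^+ 2.
Proof.
have P1 := P_gt; have c20 : 0 < c2 by rewrite /c2 cos_2psi invr_gt0; lra.
split; first by rewrite c20 /c2 cos_2psi invf_lt1; lra.
have : 0 <= cos (psi *+ 4).
  apply: cos_ge0_pihalf; have p0 := psi_gt0; have pi0 := pi_gt0 R.
  have : 16 * psi <= pi *+ 2 by rewrite -psi_N ler_pM2r // ler_nat.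
  rewrite -mulr_natl mulr2n => h; apply/andP; split; lra.
rewrite -[4%N]/(2 * 2)%N mulrnA cos_mulr2n -/c2 [_ *+ 2]mulr2n; lra.
Qed.

Let P_c2 : 2 * P - 2 = c2^-1. Proof. by rewrite /c2 cos_2psi invrK. Qed.

(** Both numbers are functions of [psi], and the comparison of their squares is
    [1 <= 2 * c2 ^+ 2]. *)
Lemma far_base_le k : C <= p k.
Proof.
have [/andP[c20 _] c2h] := c2_bounds; have c1 := C_gt1; have p1 := p_gt1 0.
rewrite p_eq -ler_sqr ?nnegrE; try lra.
rewrite C_P -/P -subr_ge0.
have -> : P - (2 * P - 1) * (P - 1) = 1 - (2 * P - 2) ^+ 2 / 2 by field.
rewrite P_c2 exprVn.
have c2s : 0 < c2 ^+ 2 by rewrite exprn_gt0.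
suff : (c2 ^+ 2)^-1 <= 2 by lra.
by rewrite -[X in _ <= X]invrK lef_pV2 ?posrE ?invr_gt0 //; lra.
Qed.

(** The cosine of [m * psi] is largest for [m = 3] if [m] is odd and for [m = 4]
    if [m] is even. *)
Lemma lateral_le k m : (3 <= m <= N - 3)%N -> ⟨L k, L (k + m)⟩ <= - C.
Proof.
move=> /andP[m3 mN]; have [/andP[c20 c21] c2h] := c2_bounds.
have psi0 := psi_gt0; have CE : C = cos psi / c2.
  by rewrite cos_psi /c -mulrA -invfM P_c2 mulVf ?invr1 ?mulr1 // gt_eqF.
have h : (2 * P - 3)^-1 = c2 / (1 - c2).
  have -> : 2 * P - 3 = (1 - c2) / c2 by rewrite mulrBl mul1r divff ?gt_eqF // -P_c2; ring.
  by rewrite invf_div.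
have c20' : c2 != 0 by rewrite gt_eqF.
have c21' : 1 - c2 != 0 by rewrite gt_eqF // subr_gt0.
have c1c1 : cos psi <= 1 by exact: cos_le1.
have c1c0 : 0 < cos psi by rewrite cos_psi; case/andP: c01.
have c2E : c2 = 2 * cos psi ^+ 2 - 1 by rewrite /c2 cos_mulr2n mulr2n; ring.
rewrite lateral_lorentz h P_c2.
have [om|om] := boolP (odd m).
  have c3 : cos (m%:R * psi) <= cos (3 * psi).
    by apply: cos_le_between psi0 psi_N _ _ => //; move: mN m3; clear; lia.
  have c3E : cos (3 * psi) - cos psi = - (2 * cos psi * (1 - c2)).
    have -> : 3 * psi = psi *+ 2 + psi by rewrite mulr2n; ring.
    by rewrite cosD -/c2 sin_mulr2n mulr2n c2E; have := sin2cos2 psi; rewrite !expr2; nra.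
  have -> : (c2^-1 * cos (m%:R * psi) - C) * (c2 / (1 - c2)) =
    (cos (m%:R * psi) - cos psi) / (1 - c2) by rewrite CE; field; rewrite c20' c21'.
  apply: (@le_trans _ _ (- (2 * cos psi))).
    rewrite ler_pdivrMr ?subr_gt0 //; lra.
  rewrite lerN2 CE ler_pdivrMr //.
  suff : cos psi <= cos psi * (2 * c2) by lra.
  have c2c2 : c2 ^+ 2 <= c2 by rewrite expr2 ger_pMr // ltW.
  by rewrite ler_pMr //; move: c2c2 c2h; lra.
have c4 : cos (m%:R * psi) <= cos (4 * psi).
  by apply: cos_le_between psi0 psi_N _ _ => //; move: mN m3 om N_even; clear; lia.
have c4E : cos (4 * psi) = 2 * c2 ^+ 2 - 1.
  have -> : 4 * psi = psi *+ 2 *+ 2 by rewrite !mulr2n; ring.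
  by rewrite cos_mulr2n -/c2 mulr2n; ring.
have -> : (c2^-1 * cos (m%:R * psi) - 1) * (c2 / (1 - c2)) =
    (cos (m%:R * psi) - c2) / (1 - c2) by field; rewrite c20' c21'.
apply: (@le_trans _ _ (- (1 + 2 * c2))).
  rewrite ler_pdivrMr ?subr_gt0 //.
  have -> : - (1 + 2 * c2) * (1 - c2) = 2 * c2 ^+ 2 - 1 - c2 by ring.
  by lra.
rewrite lerN2 CE ler_pdivrMr //.
have -> : (1 + 2 * c2) * c2 = c2 + 2 * c2 ^+ 2 by ring.
by lra.
Qed.

(** The remaining index differences, [1], [2], [N - 2] and [N - 1], belong to
    orthogonal normals. *)
Lemma lateral_pair_le j k : ⟨L j, L k⟩ < -1 -> (j < k < j + N)%N -> ⟨L j, L k⟩ <= - C.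
Proof.
move=> jk /andP[lt1 lt2]; have kE : k = (j + (k - j))%N by move: lt1; clear; lia.
have [h|h] := boolP (3 <= k - j <= N - 3)%N; first by rewrite kE lateral_le.
suff : ⟨L j, L k⟩ = 0 by move: jk => /[swap] ->; lra.
have [->|n1] := eqVneq k j.+1; first exact: L1.
have [->|n2] := eqVneq k j.+2; first exact: L2.
have [E|n3] := eqVneq (k + 1)%N (j + N)%N.
  by rewrite -(LN j) -E lorentzC addn1 L1.
have E : (k + 2)%N = (j + N)%N by move: lt1 lt2 h n1 n2 n3 N8; clear; lia.
by rewrite -(LN j) -E lorentzC addn2 L2.
Qed.

End LateralFaces.

(** * The faces of a Loebell polyhedron *)

Section LobellFaces.
Variable n : nat.

Definition lobell_code (f : lobell_face n) : option (option ('I_n + 'I_n)) :=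
  match f with
  | Top => None
  | Bottom => Some None
  | Upper i => Some (Some (inl i))
  | Lower i => Some (Some (inr i))
  end.

Definition lobell_decode (c : option (option ('I_n + 'I_n))) : lobell_face n :=
  match c with
  | None => Top
  | Some None => Bottom
  | Some (Some (inl i)) => Upper i
  | Some (Some (inr i)) => Lower i
  end.

Lemma lobell_codeK : cancel lobell_code lobell_decode.
Proof. by case. Qed.

End LobellFaces.

HB.instance Definition _ n := Equality.copy (lobell_face n) (can_type (@lobell_codeK n)).
HB.instance Definition _ n := Choice.copy (lobell_face n) (can_type (@lobell_codeK n)).
HB.instance Definition _ n := Countable.copy (lobell_face n) (can_type (@lobell_codeK n)).
HB.instance Definition _ n := Finite.copy (lobell_face n) (can_type (@lobell_codeK n)).

Section LobellCombinatorics.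
Variable n : nat.
Implicit Types (f g h : lobell_face n) (i j : 'I_n).

Lemma eq_ordS i j : (j == ordS i) = (j == (if i.+1 == n then 0 else i.+1) :> nat)%N.
Proof.
rewrite -val_eqE /=; congr (_ == _); case: eqP => [->|ne]; first by rewrite modnn.
by rewrite modn_small //; move: (ltn_ord i) ne; clear; lia.
Qed.

Lemma Upper_eqE i j : (Upper i == Upper j) = (i == j).
Proof. by apply/eqP/eqP => [[]|->]. Qed.

Lemma Lower_eqE i j : (Lower i == Lower j) = (i == j).
Proof. by apply/eqP/eqP => [[]|->]. Qed.

(** If all four colors occurred, then the color [4] would force a base into [I],
    and the three others would be colors of pairwise adjacent lateral faces
    along this base, of which there are at most two. *)
Lemma clique_misses_color (I : lobell_face n -> Prop) : (4 <= n)%N ->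
  (forall f g, I f -> I g -> f != g -> lobell_adjacent f g) ->
  exists2 c, (1 <= c <= 4)%N & forall f, I f -> lobell_color f <> c.
Proof.
move=> n4 adjI; apply: contrapT => all_colors.
have has c : (1 <= c <= 4)%N -> exists2 f, I f & lobell_color f = c.
  move=> c4; apply: contrapT => no_c; apply: all_colors; exists c => // f If fc.
  by apply: no_c; exists f.
have [f4 I4 c4] := has 4%N isT; have [f1 I1 c1] := has 1%N isT.
have [f2 I2 c2] := has 2%N isT; have [f3 I3 c3] := has 3%N isT.
have n12 : f1 != f2 by apply/eqP => E; move: c2; rewrite -E c1.
have n13 : f1 != f3 by apply/eqP => E; move: c3; rewrite -E c1.
have n23 : f2 != f3 by apply/eqP => E; move: c3; rewrite -E c2.
have n41 : f4 != f1 by apply/eqP => E; move: c1; rewrite -E c4.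
have n42 : f4 != f2 by apply/eqP => E; move: c2; rewrite -E c4.
have n43 : f4 != f3 by apply/eqP => E; move: c3; rewrite -E c4.
have := adjI _ _ I4 I1 n41; have := adjI _ _ I4 I2 n42; have := adjI _ _ I4 I3 n43.
have := adjI _ _ I1 I2 n12; have := adjI _ _ I1 I3 n13; have := adjI _ _ I2 I3 n23.
have col_lt4 m : ((m %% 3).+1 < 4)%N by rewrite ltnS ltn_mod.
have three i j l : i != j -> i != l -> j != l ->
  (j == ordS i) || (i == ordS j) -> (l == ordS i) || (i == ordS l) ->
  (l == ordS j) || (j == ordS l) -> False.
  rewrite !eq_ordS -!(inj_eq (@ord_inj n)); move: (ltn_ord i) (ltn_ord j) (ltn_ord l) n4.
  by clear; do ! case: eqP; lia.
case: f4 c4 I4 n41 n42 n43 => [||i|i] c4 I4 n41 n42 n43; last 2 first.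
- by have := col_lt4 (2 * i + 1)%N; move: c4 => /= ->.
- by have := col_lt4 (2 * i)%N; move: c4 => /= ->.
- case: f1 {I1 c1 n41} n12 n13 => // i; case: f2 {I2 c2 n42} n23 => // j; case: f3 {I3 c3 n43} => // l.
  by rewrite !Upper_eqE => jl ij il /= h1 h2 h3 _ _ _; apply: (three i j l).
- case: f1 {I1 c1 n41} n12 n13 => // i; case: f2 {I2 c2 n42} n23 => // j; case: f3 {I3 c3 n43} => // l.
  by rewrite !Lower_eqE => jl ij il /= h1 h2 h3 _ _ _; apply: (three i j l).
Qed.

Lemma lobell_color_range f : (1 <= lobell_color f <= 4)%N.
Proof. by case: f => [||i|i] //=; rewrite ltnS ltnW // ltn_mod. Qed.

(** The colors match along the step from the last to the first lateral face
    because [3] divides [n]. *)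
Lemma adjacent_color f g : (3 %| n)%N -> (1 < n)%N ->
  lobell_adjacent f g -> lobell_color f <> lobell_color g.
Proof.
move=> /dvdnP[k nk] n1.
have col_lt4 m : (m %% 3).+1 <> 4%N by move=> [E]; have := ltn_mod m 3; rewrite E.
case: f => [||i|i]; case: g => [||j|j] //=; try (by move=> _ /esym/col_lt4); try (by move=> _ /col_lt4).
all: rewrite ?eq_ordS -?(inj_eq (@ord_inj n)); move: (ltn_ord i) (ltn_ord j).
all: move: (nat_of_ord i) (nat_of_ord j) => {}i {}j; rewrite nk; clear.
all: by do ! case: eqP; lia.
Qed.

(** The cyclic order [V_0, U_0, V_1, U_1, ...] of the lateral faces. *)
Definition lateral (n0 : (0 < n)%N) (k : nat) : lobell_face n :=
  let i := Ordinal (ltn_pmod k./2 n0) in if odd k then Upper i else Lower i.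

Variable n0 : (0 < n)%N.
Local Notation lat := (lateral n0).

Lemma lateral_period k : lat (k + 2 * n) = lat k.
Proof.
have odd_k : odd (k + 2 * n) = odd k by rewrite oddD oddM addbF.
have half_k : (k + 2 * n)./2 = (k./2 + n)%N by rewrite mul2n halfD odd_double andbF doubleK.
rewrite /lateral odd_k; set i := Ordinal _; set j := Ordinal _.
by have -> : i = j by apply/val_inj; rewrite /= half_k modnDr.
Qed.

Lemma lateral_adjacent1 k : lobell_adjacent (lat k) (lat k.+1).
Proof.
rewrite /lateral /=; case: ifP => ok /=; rewrite -!val_eqE /=.
  by rewrite uphalf_half ok add1n -[X in _ || (_ == X %[mod _])]addn1 modnDml addn1 eqxx orbT.
by rewrite uphalf_half ok eqxx.
Qed.

Lemma lateral_adjacent2 k : lobell_adjacent (lat k) (lat k.+2).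
Proof.
rewrite /lateral /= negbK; case: ifP => ok /=; rewrite -!val_eqE /=.
  by rewrite -[X in (_ == X %[mod _]) || _]addn1 modnDml addn1 eqxx.
by rewrite -[X in (_ == X %[mod _]) || _]addn1 modnDml addn1 eqxx.
Qed.

Lemma lateral_distinct m : (3 <= m <= 2 * n - 3)%N ->
  lat 0 != lat m /\ ~~ lobell_adjacent (lat 0) (lat m).
Proof.
move=> m3; have hm : (m./2 < n)%N by move: m3; clear; lia.
have mE := odd_double_half m.
rewrite /lateral /=; case: ifP mE => om mE /=; split => //.
- rewrite !eq_ordS -?(inj_eq (@ord_inj n)) /= mod0n modn_small //.
  by move: m3 mE hm; move: (m./2) => h; clear; do ! case: eqP; lia.
- rewrite Lower_eqE -val_eqE /= mod0n modn_small //.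
  by move: m3 mE hm; move: (m./2) => h; clear; lia.
- rewrite !eq_ordS -?(inj_eq (@ord_inj n)) /= mod0n modn_small //.
  by move: m3 mE hm; move: (m./2) => h; clear; do ! case: eqP; lia.
Qed.

Lemma lateral_surj f : f <> Top -> f <> Bottom -> exists2 j, (j < 2 * n)%N & f = lat j.
Proof.
case: f => [||i|i] // _ _.
  exists (2 * i).+1; first by move: (ltn_ord i); clear; lia.
  rewrite /lateral /= mul2n odd_double /=; congr Upper; apply/val_inj => /=.
  by rewrite uphalf_double modn_small.
exists (2 * i)%N; first by move: (ltn_ord i); clear; lia.
rewrite /lateral /= mul2n odd_double /=; congr Lower; apply/val_inj => /=.
by rewrite doubleK modn_small.
Qed.

End LobellCombinatorics.

(** * Loebell polyhedra are right-angled systems *)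

Section LobellSystem.
Context {R : realType}.
Variables (n : nat) (e : lobell_face n -> 'cV[R]_4).
Hypothesis He : lobell_polyhedron e.

(** The normals of two faces with a common point are orthogonal to a timelike
    vector, so their product lies between [-1] and [1] and is determined by its
    arc cosine. *)
Lemma lobell_share_orth f g : share_edge e f g -> ⟨e f, e g⟩ = 0.
Proof.
move=> fg; have [[unit_e _ _ _] _ /(_ _ _ fg)] := He.
rewrite /dihedral_angle => angle.
case: fg => _ [x [[hx _] xfg]].
have xf : ⟨x, e f⟩ = 0 by apply/xfg; left.
have xg : ⟨x, e g⟩ = 0 by apply/xfg; right.
have xx : ⟨x, x⟩ < 0 by rewrite hx.1 ltrN10.
have := orth_Cauchy xx xf xg; rewrite !unit_e mulr1 -[X in _ <= X](expr1n _ 2).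
rewrite -(real_normK (num_real _)) ler_sqr ?nnegrE // ler_norml => /andP[l1 l2].
have := congr1 cos angle; rewrite acosK ?in_itv /=; last by rewrite lerNl opprK l2 lerNl.
by rewrite cos_pihalf => /eqP; rewrite oppr_eq0 => /eqP.
Qed.

Lemma lobell_disjoint f g : f != g -> ~~ lobell_adjacent f g -> ⟨e f, e g⟩ < -1.
Proof.
have [cp adj _] := He.
move=> /eqP fg nadj; apply: nonadjacent_ultraparallel cp lobell_share_orth _ _ fg _.
by move/adj; apply/negP.
Qed.

Lemma lobell_adjacent_orth f g : lobell_adjacent f g -> ⟨e f, e g⟩ = 0.
Proof. by have [_ adj _] := He; move/adj; apply: lobell_share_orth. Qed.

Lemma lobell_right_angled : right_angled_system e.
Proof.
split=> [f|f g fg]; first by have [[]] := He.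
have [/lobell_adjacent_orth|/lobell_disjoint] := boolP (lobell_adjacent f g); first by left.
by right; auto.
Qed.

Lemma lobell_orth_adjacent f g : f != g -> ⟨e f, e g⟩ = 0 -> lobell_adjacent f g.
Proof.
move=> fg fg0; apply/negPn/negP => /(lobell_disjoint fg); rewrite fg0.
by apply/negP; rewrite -leNgt oppr_le0.
Qed.

Lemma lobell_interior : exists x0, hyperboloid x0 /\ forall f, ⟨x0, e f⟩ < 0.
Proof. by have [[]] := He. Qed.

Lemma Top_Bottom_disjoint : ⟨e Top, e Bottom⟩ < -1.
Proof. exact: lobell_disjoint. Qed.

(** Every face other than the bases is lateral, and the relevant products are
    compared in [far_base_le] and [lateral_pair_le]. *)
Lemma Top_Bottom_closest f g : (8 <= n)%N ->
  ⟨e f, e g⟩ < -1 -> ⟨e f, e g⟩ <= ⟨e Top, e Bottom⟩.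
Proof.
move=> n8; have n0 : (0 < n)%N by apply: leq_trans n8.
have unit_e h : ⟨e h, e h⟩ = 1 by exact: lobell_right_angled.1.
pose L k := e (lateral n0 k).
have L1 k : ⟨L k, L k.+1⟩ = 0 by exact/lobell_adjacent_orth/lateral_adjacent1.
have L2 k : ⟨L k, L k.+2⟩ = 0 by exact/lobell_adjacent_orth/lateral_adjacent2.
have LN k : L (k + 2 * n)%N = L k by rewrite /L lateral_period.
have Lnear k : ⟨L k, near_base (e Top) (e Bottom) k⟩ = 0.
  by rewrite /L /near_base /lateral; case: (odd k); apply: lobell_adjacent_orth.
have Lfar k : ⟨L k, far_base (e Top) (e Bottom) k⟩ < -1.
  by rewrite /L /far_base /lateral; case: (odd k); apply: lobell_disjoint.
have N_even : ~~ odd (2 * n) by rewrite oddM.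
have N16 : (16 <= 2 * n)%N by move: n8; clear; lia.
have Ldisj m : (3 <= m <= 2 * n - 3)%N -> ⟨L 0%N, L m⟩ < -1.
  by move=> /(lateral_distinct n0)[ne nadj]; apply: lobell_disjoint.
have TT := unit_e Top; have BB := unit_e Bottom; have LL k := unit_e (lateral n0 k).
have le_far k : ⟨L k, far_base (e Top) (e Bottom) k⟩ <= ⟨e Top, e Bottom⟩.
  rewrite -lerN2.
  exact: (far_base_le TT BB Top_Bottom_disjoint LL L1 L2 LN Lnear Lfar N_even N16 Ldisj).
have le_pair j k : (j < k < j + 2 * n)%N -> ⟨L j, L k⟩ < -1 -> ⟨L j, L k⟩ <= ⟨e Top, e Bottom⟩.
  move=> jk Ljk; rewrite -[X in _ <= X]opprK.
  exact: (lateral_pair_le TT BB Top_Bottom_disjoint LL L1 L2 LN Lnear Lfar N_even N16 Ldisj).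
have base_le (b : lobell_face n) k : b = Top \/ b = Bottom ->
  ⟨e b, L k⟩ < -1 -> ⟨e b, L k⟩ <= ⟨e Top, e Bottom⟩.
  move=> hb bk; have := Lnear k; have := le_far k; rewrite /near_base /far_base !(lorentzC (L k)).
  by case: hb bk => ->; case: (odd k) => // h1 h2 h3; move: h1; rewrite h3 ltr0N1.
have [->|fT] := eqVneq f Top.
  have [->|gT] := eqVneq g Top; first by rewrite TT; lra.
  have [->//|gB] := eqVneq g Bottom.
  have [k _ ->] := lateral_surj n0 (elimN eqP gT) (elimN eqP gB).
  by apply: base_le; left.
have [->|fB] := eqVneq f Bottom.
  have [->|gT] := eqVneq g Top; first by rewrite lorentzC.
  have [->|gB] := eqVneq g Bottom; first by rewrite BB; lra.
  have [k _ ->] := lateral_surj n0 (elimN eqP gT) (elimN eqP gB).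
  by apply: base_le; right.
have [j jn ->] := lateral_surj n0 (elimN eqP fT) (elimN eqP fB).
have [->|gT] := eqVneq g Top; first by rewrite lorentzC; apply: base_le; left.
have [->|gB] := eqVneq g Bottom; first by rewrite lorentzC; apply: base_le; right.
have [k kn ->] := lateral_surj n0 (elimN eqP gT) (elimN eqP gB).
case: (ltngtP j k) => jk.
- by apply: le_pair; rewrite jk ltn_addl.
- by rewrite lorentzC; apply: le_pair; rewrite jk ltn_addl.
- by rewrite jk -/(L k) LL; lra.
Qed.

End LobellSystem.

(** * The coloring homomorphism *)

Section ColorVectors.
Variables v1 v2 v3 : 'rV['F_2]_3.
Hypothesis basis_v : basis_of fullv [:: v1; v2; v3].

Lemma F2_addrr (c : 'rV['F_2]_3) : c + c = 0.
Proof.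
apply/rowP => i; rewrite !mxE -mulr2n -mulr_natr.
by rewrite (_ : 2%:R = 0 :> 'F_2) ?mulr0 //; apply/val_inj.
Qed.

Let X := [tuple v1; v2; v3].
Let basis_X : basis_of fullv X. Proof. by []. Qed.

Definition parity (i : 'I_3) (v : 'rV['F_2]_3) : bool := coord X i v != 0.

Lemma parityD i : {morph parity i : u v / u + v >-> u (+) v}.
Proof.
move=> u v; rewrite /parity linearD /=.
by case: (coord X i u) (coord X i v) => [[|[]]// ?] [[|[]]// ?].
Qed.

Lemma parity_basis i (j : 'I_3) : parity i X`_j = (i == j).
Proof.
rewrite /parity coord_free ?(basis_free basis_X) // (eq_sym j i).
by case: (i == j); rewrite ?oner_neq0 ?eqxx.
Qed.

Local Notation cv := (color_vector v1 v2 v3).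

Lemma parity_color i c : (1 <= c <= 4)%N -> parity i (cv c) = (c == i.+1) || (c == 4%N).
Proof.
have p1 := parity_basis i ord0; have p2 := parity_basis i (lift ord0 ord0).
have p3 := parity_basis i (lift ord0 (lift ord0 ord0)); rewrite /= in p1 p2 p3.
case: c => [|[|[|[|[|c]]]]] //= _; rewrite ?parityD ?p1 ?p2 ?p3 -?val_eqE /=;
  by case: i {p1 p2 p3} => [[|[|[|i]]]].
Qed.

(** The only relation between the four color vectors is their sum, so there is a
    linear form that is [1] on two of them and [0] on the two others. *)
Lemma color_separation a c : (1 <= a <= 4)%N -> (1 <= c <= 4)%N -> a <> c ->
  exists lam : 'rV['F_2]_3 -> bool, [/\ {morph lam : u v / u + v >-> u (+) v},
    lam (cv a) & forall b, (1 <= b <= 4)%N -> b <> a -> b <> c -> lam (cv b) = false].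
Proof.
pose i1 : 'I_3 := ord0; pose i2 : 'I_3 := lift ord0 ord0.
pose i3 : 'I_3 := lift ord0 (lift ord0 ord0).
have addM i j : {morph (fun v => parity i v (+) parity j v) : u v / u + v >-> u (+) v}.
  by move=> u v; rewrite !parityD addbACA.
(* the forms of sep1 single out {i, 4} and those of sep2 single out {i, j} *)
have sep1 (i : 'I_3) : exists lam : 'rV['F_2]_3 -> bool, {morph lam : u v / u + v >-> u (+) v}
    /\ forall b, (1 <= b <= 4)%N -> lam (cv b) = (b == i.+1) || (b == 4%N).
  by exists (parity i); split; [exact: parityD|move=> b; exact: parity_color].
have sep2 (i j : 'I_3) : exists lam : 'rV['F_2]_3 -> bool, {morph lam : u v / u + v >-> u (+) v}
    /\ forall b, (1 <= b <= 4)%N -> lam (cv b) = ((b == i.+1) || (b == 4%N)) (+) ((b == j.+1) || (b == 4%N)).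
  by exists (fun v => parity i v (+) parity j v); split; [exact: addM|move=> b hb; rewrite !parity_color].
have use (lam : 'rV['F_2]_3 -> bool) (Q : nat -> bool) :
    {morph lam : u v / u + v >-> u (+) v} /\ (forall b, (1 <= b <= 4)%N -> lam (cv b) = Q b) ->
    (1 <= a <= 4)%N -> Q a -> (forall b, (1 <= b <= 4)%N -> b <> a -> b <> c -> Q b = false) ->
  [/\ {morph lam : u v / u + v >-> u (+) v},
    lam (cv a) & forall b, (1 <= b <= 4)%N -> b <> a -> b <> c -> lam (cv b) = false].
  move=> [lamD lamQ] a4 Qa Qb; split=> //; first by rewrite lamQ.
  by move=> b b4 ba bc; rewrite lamQ // Qb.
move=> a4 c4 ac.
have [l1 h1] := sep1 i1; have [l2 h2] := sep1 i2; have [l3 h3] := sep1 i3.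
have [l12 h12] := sep2 i1 i2; have [l13 h13] := sep2 i1 i3; have [l23 h23] := sep2 i2 i3.
move: a4 c4 ac use; case: a => [|[|[|[|[|a]]]]] // _; case: c => [|[|[|[|[|c]]]]] // _ ac use.
all: first [ by exists l1; apply: (use _ _ h1) => // -[|[|[|[|[|b]]]]]
           | by exists l2; apply: (use _ _ h2) => // -[|[|[|[|[|b]]]]]
           | by exists l3; apply: (use _ _ h3) => // -[|[|[|[|[|b]]]]]
           | by exists l12; apply: (use _ _ h12) => // -[|[|[|[|[|b]]]]]
           | by exists l13; apply: (use _ _ h13) => // -[|[|[|[|[|b]]]]]
           | by exists l23; apply: (use _ _ h23) => // -[|[|[|[|[|b]]]]] ].
Qed.

(** The sum of the coordinates is [1] on the basis, hence also on the sum of its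
    three vectors. *)
Lemma parity_sum : exists lam : 'rV['F_2]_3 -> bool,
  {morph lam : u v / u + v >-> u (+) v} /\ forall c, (1 <= c <= 4)%N -> lam (cv c).
Proof.
exists (fun v => parity ord0 v (+) parity (lift ord0 ord0) v
                 (+) parity (lift ord0 (lift ord0 ord0)) v); split.
  by move=> u v; rewrite !parityD; do 6! case: (parity _ _).
by move=> c hc; rewrite !parity_color //; move: hc; case: c => [|[|[|[|[|c]]]]].
Qed.

Lemma color_span v : exists s : seq nat, {subset s <= [:: 1; 2; 3]%N} /\ v = \sum_(c <- s) cv c.
Proof.
have := coord_basis basis_X (memvf v); rewrite !big_ord_recl big_ord0 /= addr0 => vE.
have F2 (a : 'F_2) c : (1 <= c <= 3)%N -> exists s : seq nat,
    {subset s <= [:: 1; 2; 3]%N} /\ a *: cv c = \sum_(c <- s) cv c.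
  move=> hc; have [->|a0] := eqVneq a 0.
    by exists [::]; rewrite scale0r big_nil.
  exists [:: c]; split.
    by move=> b; rewrite inE => /eqP ->; move: hc; case: c => [|[|[|[|c]]]].
  rewrite big_seq1 (_ : a = 1) ?scale1r //.
  by case: a a0 => [[|[]]// ?] _; apply/val_inj.
have [s1 [h1 E1]] := F2 (coord X ord0 v) 1%N isT.
have [s2 [h2 E2]] := F2 (coord X (lift ord0 ord0) v) 2%N isT.
have [s3 [h3 E3]] := F2 (coord X (lift ord0 (lift ord0 ord0)) v) 3%N isT.
exists (s1 ++ s2 ++ s3); split.
  by move=> b; rewrite !mem_cat => /or3P[/h1|/h2|/h3].
by rewrite !big_cat /= -E1 -E2 -E3.
Qed.

End ColorVectors.

Section LobellColoring.
Context {R : realType}.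
Variables (k : nat) (e : lobell_face (3 * k) -> 'cV[R]_4).
Variables v1 v2 v3 : 'rV['F_2]_3.
Hypotheses (k2 : (2 <= k)%N) (He : lobell_polyhedron e).
Hypothesis basis_v : basis_of fullv [:: v1; v2; v3].

Let col (f : lobell_face (3 * k)) := color_vector v1 v2 v3 (lobell_color f).
Let ras := lobell_right_angled He.

(** The color of a group element is the color of any word for it. *)
Lemma coloring_hom_exists : exists phi, coloring_hom e v1 v2 v3 phi.
Proof.
have [x0 [hx0 x0e]] := lobell_interior He.
pose phi (g : 'M[R]_4) := xget 0 [set c | exists2 w, g = word_mx e w & c = word_color col w]%classic.
have phiE w : phi (word_mx e w) = word_color col w.
  rewrite /phi; have [|v vE ->] := @xgetPex _ 0
    [set c | exists2 v, word_mx e w = word_mx e v & c = word_color col v]%classic.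
    by exists (word_color col w), w.
  exact: (word_color_inj ras x0e col F2_addrr (esym vE)).
exists phi; split=> [g h /(reflection_group_word ras)[v ->] /(reflection_group_word ras)[w ->]|f].
  by rewrite -word_mx_cat !phiE word_color_cat.
by rewrite -[reflection _]mulr1 -[_ * 1]/(word_mx e [:: f]) phiE /word_color big_seq1.
Qed.

Variable phi : 'M[R]_4 -> 'rV['F_2]_3.
Hypothesis Hphi : coloring_hom e v1 v2 v3 phi.
Local Notation G := (reflection_group e).
Local Notation K := (coloring_kernel e phi).

Let G_word w : G (word_mx e w). Proof. by apply/(reflection_group_word ras); exists w. Qed.

Lemma coloring_word w : phi (word_mx e w) = word_color col w.
Proof.
have [phiM phir] := Hphi; elim: w => [|t w IH].
  have := phiM _ _ (G_word [::]) (G_word [::]); rewrite mulr1 /word_color big_nil.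
  by move/(congr1 (fun v => v - phi 1)); rewrite subrr addrK.
rewrite /= phiM //; first by rewrite IH phir /word_color big_cons.
by have := G_word [:: t]; rewrite /= mulr1.
Qed.

Lemma kernel_word g : K g <-> exists2 w, g = word_mx e w & word_color col w = 0.
Proof.
split=> [[/(reflection_group_word ras)[w ->]]|[w -> w0]].
  by rewrite coloring_word; exists w.
by split=> //; rewrite coloring_word.
Qed.

Lemma kernel_torsion_free : torsion_free K.
Proof.
have [x0 [hx0 x0e]] := lobell_interior He.
move=> g m /kernel_word[w -> w0] m0 wm; move: w0 m0 wm.
apply: (word_torsion_free ras hx0 x0e); first exact: F2_addrr.
move=> I f If orthI.
have adjI g' h : I g' -> I h -> g' != h -> lobell_adjacent g' h.
  by move=> Ig Ih gh; apply: (lobell_orth_adjacent He) => //; apply: orthI.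
have n4 : (4 <= 3 * k)%N by move: k2; clear; lia.
have [c c4 cI] := clique_misses_color n4 adjI.
have [lam [lamD lamf lamI]] := color_separation basis_v (lobell_color_range f) c4 (cI f If).
exists lam; split=> // h Ih hf; apply: lamI (lobell_color_range h) _ (cI h Ih).
apply: adjacent_color; [by rewrite dvdn_mulr|by move: k2; clear; lia|exact: adjI].
Qed.

(** The determinant and the linear form of [parity_sum] both count the letters
    of a word modulo [2]. *)
Lemma kernel_orientable : orientable_quotient K.
Proof.
have [lam [lamD lam1]] := parity_sum basis_v.
have lam0 : lam 0 = false by have := lamD 0 0; rewrite addr0; case: (lam 0).
have detE w : \det (word_mx e w) = (-1) ^+ (lam (word_color col w)).
  elim: w => [|t w IH]; first by rewrite /word_color big_nil lam0 expr0 det1.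
  rewrite /= -[_ * _]/(_ *m _) det_mulmx IH det_reflection; last exact: ras.1.
  rewrite /word_color big_cons lamD lam1 ?lobell_color_range //.
  by case: (lam _); rewrite /= ?expr0 ?expr1; ring.
by move=> _ /kernel_word[w -> w0]; rewrite detE w0 lam0 expr0.
Qed.

Lemma coloring_onto v : exists w, word_color col w = v.
Proof.
have [s [s123 ->]] := color_span basis_v v.
elim: s s123 => [|c s IH] s123; first by exists [::]; rewrite /word_color !big_nil.
have [|w wE] := IH; first by move=> b bs; apply: s123; rewrite inE bs orbT.
have h0 : (0 < 3 * k)%N by move: k2; clear; lia.
have h1 : (1 < 3 * k)%N by move: k2; clear; lia.
have [f fc] : exists f : lobell_face (3 * k), lobell_color f = c.
  have := s123 c; rewrite mem_head => /(_ isT); rewrite !inE => /or3P[] /eqP ->.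
  - by exists (Lower (Ordinal h0)).
  - by exists (Upper (Ordinal h0)).
  - by exists (Lower (Ordinal h1)).
by exists (f :: w); rewrite /word_color !big_cons -/(word_color col w) wE /col fc.
Qed.

Lemma kernel_subgroup : subgroup K.
Proof.
split.
- by apply/kernel_word; exists [::]; rewrite // /word_color big_nil.
- move=> _ _ /kernel_word[v -> v0] /kernel_word[w -> w0]; apply/kernel_word.
  by exists (v ++ w); rewrite ?word_mx_cat // word_color_cat v0 w0 addr0.
- move=> _ /kernel_word[w -> w0]; apply/kernel_word.
  by exists (rev w); rewrite ?word_mxV // word_color_rev.
Qed.

(** The cosets of the kernel are the fibers of the coloring homomorphism. *)
Lemma kernel_index : (left_cosets G K #= `I_8)%card.
Proof.
pose fiber v : set 'M[R]_4 := [set g | G g /\ phi g = v]%classic.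
have cosetE w : [set word_mx e w * h | h in K]%classic = fiber (word_color col w).
  apply/seteqP; split=> [_ [_ /kernel_word[v -> v0] <-]|g [/(reflection_group_word ras)[v ->]]].
    by rewrite -word_mx_cat; split=> //; rewrite coloring_word word_color_cat v0 addr0.
  rewrite coloring_word => vw; exists (word_mx e (rev w ++ v)).
    apply/kernel_word; exists (rev w ++ v) => //.
    by rewrite word_color_cat word_color_rev vw F2_addrr.
  by rewrite word_mx_cat mulrA -word_mxV // mulrV ?mul1r // word_mx_unit.
have -> : left_cosets G K = [set fiber v | v in setT]%classic.
  apply/seteqP; split=> [_ [_ /(reflection_group_word ras)[w ->] <-]|_ [v _ <-]].
    by exists (word_color col w) => //; rewrite cosetE.
  have [w <-] := coloring_onto v.
  by exists (word_mx e w); [exact: G_word|rewrite cosetE].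
apply: card_eq_trans (inj_card_eq _) _.
  move=> u v _ _ uv; have [w wu] := coloring_onto u.
  have : fiber u (word_mx e w) by split; rewrite ?coloring_word.
  by rewrite uv => -[_]; rewrite coloring_word wu.
have <- : [set (enum_rank v : nat) | v in [set: 'rV['F_2]_3]]%classic = `I_8.
  have c8 : #|{: 'rV['F_2]_3}| = 8%N by rewrite card_mx card_Fp.
  apply/seteqP; split=> [_ [v _ <-]|i i8] /=; first by rewrite -c8.
  have i8' : (i < #|{: 'rV['F_2]_3}|)%N by rewrite c8.
  by exists (enum_val (Ordinal i8')); rewrite // enum_valK.
by rewrite card_eq_sym; apply: inj_card_eq => u v _ _ /ord_inj/enum_rank_inj.
Qed.

(** The reflections in the bases have the same color, so their product lies in
    the kernel. *)
Lemma kernel_loxodromic : exists2 g, K g & loxodromic g (2 * face_distance e Top Bottom).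
Proof.
have [x0 [hx0 x0e]] := lobell_interior He.
have TB := Top_Bottom_disjoint He.
rewrite (face_distance_perpendicular ras hx0 x0e TB).
exists (reflection (e Bottom) * reflection (e Top)); last first.
  exact: (perpendicular_loxodromic ras hx0 x0e TB).
apply/kernel_word; exists [:: Bottom; Top]; first by rewrite /= mulr1.
by rewrite /word_color !big_cons big_nil addr0 F2_addrr.
Qed.

Lemma kernel_closed_geodesic : has_closed_geodesic K (2 * face_distance e Top Bottom).
Proof.
have [g Kg [l0 [c gc gl]]] := kernel_loxodromic; split=> //; exists c => // t.
have [_ KM KV] := kernel_subgroup.
have gu : g \is a GRing.unit.
  by case/kernel_word: (Kg) => w -> _; apply: word_mx_unit.
apply/seteqP; split=> [_ [h Kh <-]|_ [h Kh <-]].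
  by exists (h * g); [exact: KM|rewrite -gl mulmxA].
by exists (h * g^-1); [apply: KM => //; exact: KV|rewrite -gl mulmxA -[_ *m g]/(_ * g) divrK].
Qed.

(** [3 <= k] gives [8 <= 3 * k], as [Top_Bottom_closest] requires. *)
Lemma kernel_systole : (3 <= k)%N -> is_systole K (2 * face_distance e Top Bottom).
Proof.
move=> k3; split; first exact: kernel_loxodromic.
have [x0 [hx0 x0e]] := lobell_interior He.
have TB := Top_Bottom_disjoint He.
rewrite (face_distance_perpendicular ras hx0 x0e TB).
set C := - ⟨e Top, e Bottom⟩.
have C1 : 1 <= C by rewrite /C lerNr ltW.
move=> g l /kernel_word[w -> _] lox; have [l0 _] := lox.
have n8 : (8 <= 3 * k)%N by move: k3; clear; lia.
have cp : compact_polyhedron e by case: He.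
have le_C f h : ⟨e f, e h⟩ < -1 -> ⟨e f, e h⟩ <= - C.
  by rewrite /C opprK; apply: (Top_Bottom_closest He).
have bound := polyhedron_lorentz_bound cp.
have := translation_length_bound ras hx0 x0e bound C1 le_C lox.
have D0 : 0 <= 2 * arcosh C by rewrite mulr_ge0 ?arcosh_ge0.
have -> : 2 * C ^+ 2 - 1 = cosh (2 * arcosh C).
  have -> : 2 * arcosh C = arcosh C + arcosh C by ring.
  rewrite coshD -!expr2; have := cosh_sq (arcosh C); rewrite cosh_arcosh // => CS.
  by rewrite -[in RHS](addrK 1 (sinh _ ^+ 2)) [sinh _ ^+ 2 + 1]addrC -CS; ring.
by move/(arcosh_le (cosh_ge1 _)); rewrite !arcosh_cosh // ltW.
Qed.

End LobellColoring.

Theorem mainTheorem7 (R : realType) :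
  (forall (k : nat) (e : lobell_face (3 * k) -> 'cV[R]_4)
      (v1 v2 v3 : 'rV['F_2]_3),
    (2 <= k)%N -> lobell_polyhedron e ->
    basis_of fullv [:: v1; v2; v3] ->
    (exists phi, coloring_hom e v1 v2 v3 phi) /\
    (forall phi, coloring_hom e v1 v2 v3 phi ->
      [/\ manifold_cover (reflection_group e) (coloring_kernel e phi) 8,
          orientable_quotient (coloring_kernel e phi)
        & has_closed_geodesic (coloring_kernel e phi)
            (2 * face_distance e Top Bottom)])) /\
  (exists K : nat, forall (k : nat) (e : lobell_face (3 * k) -> 'cV[R]_4)
      (v1 v2 v3 : 'rV['F_2]_3) (phi : 'M[R]_4 -> 'rV['F_2]_3),
    (2 <= k)%N -> (K <= k)%N -> lobell_polyhedron e ->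
    basis_of fullv [:: v1; v2; v3] ->
    coloring_hom e v1 v2 v3 phi ->
    is_systole (coloring_kernel e phi) (2 * face_distance e Top Bottom)).
Proof.
split.
  move=> k e v1 v2 v3 k2 He basis_v; split; first exact: coloring_hom_exists.
  move=> phi Hphi; split; last 2 first.
  - exact: kernel_orientable Hphi.
  - exact: kernel_closed_geodesic Hphi.
  split; [exact: kernel_subgroup Hphi|by move=> g []|exact: kernel_torsion_free Hphi|].
  exact: kernel_index Hphi.
exists 3%N => k e v1 v2 v3 phi _ k3 He _ Hphi.
exact: kernel_systole Hphi k3.
Qed.
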